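(* Suppose that the Jacobi operator $J$ is positive, let $J_F$ be its Friedrichs extension, and suppose that $J_F^{-1}$ is compact. Let $\sigma(J_F)=\{\zeta_j:j\ge1\}$ be ordered so that $0<\zeta_1<\zeta_2<\cdots$. Suppose that for some continuous non-decreasing function $w:\mathbb{R}\to(0,\infty)$ we have $$\sum_{j=1}^\infty\frac{1}{w(\zeta_j)}<\infty.$$ Then for any bounded continuous function $f$ on $\mathbb{R}$ such that $\|wf\|_\infty<\infty$ (supremum norm) we have $$\lim_{n\to\infty}\int_{\mathbb{R}}f\,\mathrm{d}\nu_n=\int_{\mathbb{R}}f\,\mathrm{d}\nu_\infty,$$ where $\nu_n=\sum_{j=1}^n\delta_{x_{j;n}}$ is the zero counting measure of the orthogonal polynomial $P_n$, with zeros $x_{1;n}<\cdots<x_{n;n}$, and $\nu_\infty=\sum_{j=1}^\infty\delta_{\zeta_j}$.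
   Context: Let $(a_n)_{n\ge0}$ be positive numbers, $(b_n)_{n\ge0}$ real numbers. The Jacobi operator $J$ is the closure in $\ell^2(\mathbb{N}_0)$, $\mathbb{N}_0=\{0,1,2,\dots\}$, of the action on finitely supported sequences of the infinite symmetric tridiagonal matrix with diagonal entries $b_0,b_1,\dots$ and off-diagonal entries $a_0,a_1,\dots$. If $J$ is self-adjoint then $J_F=J$. The orthonormal polynomials are $P_0\equiv1$, $P_1(z)=(z-b_0)/a_0$, $zP_n(z)=a_{n-1}P_{n-1}(z)+b_nP_n(z)+a_nP_{n+1}(z)$, $n\ge1$; the $n$ zeros of $P_n$ are real and simple. $\delta_x$ denotes the Dirac measure at $x$. *)

(* Defs.v *)
From HB Require Import structures.
From mathcomp Require Import all_boot all_order all_algebra.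
From mathcomp Require Import complex.
From mathcomp Require Import all_classical all_reals all_analysis.

Set Implicit Arguments.
Unset Strict Implicit.
Unset Printing Implicit Defensive.
Import Order.TTheory GRing.Theory Num.Theory.
Import numFieldNormedType.Exports.
Local Open Scope classical_set_scope.
Local Open Scope ring_scope.
Local Open Scope complex_scope.

Section HilbertSpace.
Variable R : realType.
Implicit Types (u v : nat -> R[i]).

(* Extended-real valued, so that it is +oo exactly off l^2. *)
Definition normsq u : \bar R :=
  (\sum_(0 <= k <oo) (Normc.normc (u k) ^+ 2)%:E)%E.

Definition ell2 : set (nat -> R[i]) := [set u | (normsq u < +oo)%E].

(* Meaningful on l^2 only; linear in the first argument. *)
Definition dot u v : R[i] :=
  limn (series (fun k => complex.Re (u k * (v k)^*%C)))
    +i* limn (series (fun k => complex.Im (u k * (v k)^*%C))).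

Definition ell2_cvg (un : nat -> nat -> R[i]) u : Prop :=
  normsq (un n \- u) @[n --> \oo] --> 0%E.

(* [R[i]] carries no canonical topology: convergence is that of the modulus
   of the difference. *)
Definition complex_cvg (c : nat -> R[i]) (l : R[i]) : Prop :=
  Normc.normc (c n - l) @[n --> \oo] --> (0 : R).

End HilbertSpace.

(* An unbounded operator is identified with its graph: [T (u, v)] means that
   u is in the domain of T and T u = v. *)
Notation operator R := (set ((nat -> R[i]) * (nat -> R[i]))).

Section Operators.
Variable R : realType.
Implicit Types (T : operator R) (u v : nat -> R[i]) (z : R[i]).

Definition op_closure T : operator R :=
  [set p | [/\ ell2 p.1, ell2 p.2 &
     exists un vn : nat -> nat -> R[i],
       [/\ forall n, T (un n, vn n), ell2_cvg un p.1 & ell2_cvg vn p.2]]].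

Definition op_inverse T : operator R := [set p | T (p.2, p.1)].

Definition op_shift T z : operator R :=
  [set p | exists2 v, T (p.1, v) & p.2 = v \- (fun k => z * p.1 k)].

(* The order of [R[i]] makes [0 <= c] mean that c is real and nonnegative. *)
Definition op_positive T : Prop :=
  forall u v, T (u, v) -> 0 <= dot v u.

Definition everywhere_defined T : Prop :=
  forall u, ell2 u -> exists! v, T (u, v).

Definition bounded_op T : Prop :=
  everywhere_defined T /\
  exists M : R, forall u v, T (u, v) -> (normsq v <= M%:E * normsq u)%E.

Definition compact_op T : Prop :=
  everywhere_defined T /\
  forall un vn : nat -> nat -> R[i],
    (exists M : R, forall n, (normsq (un n) <= M%:E)%E) ->
    (forall n, T (un n, vn n)) ->
    exists (phi : nat -> nat) v,
      [/\ {homo phi : m n / (m < n)%N}, ell2 v & ell2_cvg (vn \o phi) v].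

Definition resolvent_set T : set R[i] :=
  [set z | bounded_op (op_inverse (op_shift T z))].

Definition spectrum T : set R[i] := ~` resolvent_set T.

(* Sesquilinear form t[u, v] = <T u, v> on the domain of T, for T positive and
   symmetric: [form_seq T un vn u] says that un is a sequence in the domain of
   T, with T (un n) = vn n, that converges to u in l^2 and is Cauchy for t. *)
Definition form_seq T (un vn : nat -> nat -> R[i]) u : Prop :=
  [/\ ell2 u, forall n, T (un n, vn n), ell2_cvg un u &
    forall eps : R, 0 < eps -> exists N, forall n m, (N <= n)%N -> (N <= m)%N ->
      Normc.normc (dot (vn n \- vn m) (un n \- un m)) < eps].

Definition closed_form_domain T : set (nat -> R[i]) :=
  [set u | exists un vn, form_seq T un vn u].

(* [closed_form T u v c]: the closure of t takes the value c at (u, v). *)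
Definition closed_form T u v (c : R[i]) : Prop :=
  exists un un' vn vn',
    [/\ form_seq T un un' u, form_seq T vn vn' v &
        complex_cvg (fun n => dot (un' n) (vn n)) c].

(* The operator associated with the closure of t. *)
Definition friedrichs T : operator R :=
  [set p | [/\ closed_form_domain T p.1, ell2 p.2 &
     forall v, closed_form_domain T v -> closed_form T p.1 v (dot p.2 v)]].

End Operators.

Section Jacobi.
Variables (R : realType) (a b : nat -> R).

Definition finitely_supported (u : nat -> R[i]) : Prop :=
  exists N, forall n, (N <= n)%N -> u n = 0.

Definition jacobi_action (u : nat -> R[i]) (n : nat) : R[i] :=
  (if n is m.+1 then (a m)%:C * u m else 0)
  + (b n)%:C * u n + (a n)%:C * u n.+1.

Definition jacobi : operator R :=
  op_closure [set p | finitely_supported p.1 /\ p.2 = jacobi_action p.1].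

Fixpoint orthonormal_poly (n : nat) : {poly R} :=
  if n is m.+1 then
    (a m)^-1 *: (('X - (b m)%:P) * orthonormal_poly m
                 - (if m is k.+1 then a k *: orthonormal_poly k else 0))
  else 1.

End Jacobi.

Section CountingMeasures.
Variable R : realType.

(* [x n j] with j < n stands for the (j+1)-st zero of the n-th polynomial. *)
Definition zero_counting_measure (x : nat -> nat -> R) (n : nat) :
    {measure set R -> \bar R} :=
  msum (fun j => \d_(x n j)) n.

Definition point_counting_measure (zeta : nat -> R) :
    {measure set R -> \bar R} :=
  mseries (fun j => \d_(zeta j)) 0.

End CountingMeasures.

(* Main.v *)
(* Let J_n be the n x n truncation of J; its eigenvalues are the zeros of P_n, and
   by interlacing the j-th zero decreases in n, to a limit l_j >= 0.

   Write K for the inverse of J_F and K_n h for the solution of J_n y = P_n h.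
   Since K_n h is the projection of K h for the quadratic form of J, the defect
   K - K_n is nonnegative, bounded by K, and tends strongly to 0; as K is compact,
   a bounded sequence h_n makes K_n h_n precompact. Applied to the normalized
   eigenvectors of J_n, this shows that every l_j is an eigenvalue of J_F and that
   the l_j are distinct, since limits of orthogonal eigenvectors stay orthogonal
   whereas an eigenvalue of a Jacobi operator is simple. Applied to the solutions
   of (J_n - z) y = P_n g, which are bounded as soon as z is not among the l_j, it
   shows that such a z is in the resolvent set. Hence l_j = zeta_j.

   So the j-th zero of P_n decreases to zeta_j, |f| is at most M / w (zeta_j)
   there, and the limit can be taken term by term.

   Only the real part [rdot] of the inner product is needed: the forms involved
   are real on the diagonal. *)
Require Import Defs.
From HB Require Import structures.
From mathcomp Require Import all_boot all_order all_algebra.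
From mathcomp Require Import complex.
From mathcomp Require Import all_classical all_reals all_analysis.
From mathcomp Require Import measurable_realfun ring lra zify.
Import Order.TTheory GRing.Theory Num.Theory.
Import numFieldNormedType.Exports.
Local Open Scope classical_set_scope.
Local Open Scope ring_scope.
Local Open Scope complex_scope.

Set Implicit Arguments.
Unset Strict Implicit.
Unset Printing Implicit Defensive.

(** * The real inner product of l^2 *)

(** Source of the three Cauchy-Schwarz inequalities below: for the inner product, for the form of
    [J] and for the Galerkin defect. Semidefinite forms occur, hence the case [C = 0]. *)
Lemma discr_le (R : realFieldType) (A B C : R) : 0 <= C ->
  (forall t : R, 0 <= A + t * (2 * B) + t ^+ 2 * C) -> B ^+ 2 <= A * C.
Proof.
rewrite le_eqVlt => /orP[/eqP <- H|C0 H].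
  rewrite mulr0; have [->|B0] := eqVneq B 0; first by rewrite expr0n.
  (* With [C = 0] the expression is affine in [t]; this [t] gives it the value -1. *)
  have := H (- (A + 1) / (2 * B)).
  rewrite !mulr0 addr0 divfK; last by rewrite mulf_neq0 // pnatr_eq0.
  lra.
have := H (- B / C).
have -> : A + - B / C * (2 * B) + (- B / C) ^+ 2 * C = (A * C - B ^+ 2) / C.
  by field; rewrite gt_eqF.
by rewrite ler_pdivlMr // mul0r subr_ge0.
Qed.

Lemma cvg0_le (R : realType) (f g : nat -> R) : (forall n, 0 <= f n <= g n) ->
  g n @[n --> \oo] --> 0 -> f n @[n --> \oo] --> 0.
Proof.
by move=> fg g0; apply: squeeze_cvgr (cvg_cst 0) g0; exact: nearW.
Qed.

Lemma cvg_sqrt0 (R : realType) (f : nat -> R) :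
  f n @[n --> \oo] --> 0 -> Num.sqrt (f n) @[n --> \oo] --> 0.
Proof.
by move=> f0; rewrite -(sqrtr0 R); apply: continuous_cvg => //; exact: sqrt_continuous.
Qed.

Lemma cvg_ge_id (phi : nat -> nat) : (forall n, n <= phi n)%N ->
  phi n @[n --> \oo] --> \oo.
Proof.
by move=> phin P [N _ NP]; exists N => // n /= Nn; apply: NP; exact: leq_trans Nn _.
Qed.

Lemma homo_ltn_ge (phi : nat -> nat) : {homo phi : m n / (m < n)%N} ->
  forall n, (n <= phi n)%N.
Proof.
by move=> h; elim=> // n ih; exact: leq_ltn_trans ih (h _ _ (ltnSn n)).
Qed.

Section Ell2.
Variable R : realType.
Implicit Types (u v w : nat -> R[i]) (r : R).

Definition rterm u v (k : nat) : R :=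
  complex.Re (u k) * complex.Re (v k) + complex.Im (u k) * complex.Im (v k).

Definition rdot u v : R := limn (series (rterm u v)).

Local Notation sqn u := (rdot u u).

(** One combinator for sums, differences ([r = -1]) and real multiples ([u = 0]), so that each rule
    of bilinearity is proved once. *)
Definition lc r u v : nat -> R[i] := fun k => u k + r%:C * v k.

Definition sqd u v : R := sqn (lc (-1) u v).

Lemma rtermE u v k : complex.Re (u k * (v k)^*%C) = rterm u v k.
Proof. by rewrite /rterm; case: (u k) => a b; case: (v k) => c d /=; ring. Qed.

Lemma Re_dot u v : complex.Re (dot u v) = rdot u v.
Proof. by rewrite /dot /rdot /=; under eq_fun do rewrite rtermE. Qed.

Lemma normc_sq (z : R[i]) :
  Normc.normc z ^+ 2 = complex.Re z ^+ 2 + complex.Im z ^+ 2.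
Proof. by case: z => a b /=; rewrite sqr_sqrtr // addr_ge0 ?sqr_ge0. Qed.

Lemma normc_ge_absRe (z : R[i]) : `|complex.Re z| <= Normc.normc z.
Proof.
rewrite -(@ler_pXn2r _ 2) ?nnegrE //; first last.
- by case: z => a b /=; exact: sqrtr_ge0.
- by rewrite normc_sq real_normK ?num_real // lerDl sqr_ge0.
Qed.

Lemma Re_lc r u v k :
  complex.Re (lc r u v k) = complex.Re (u k) + r * complex.Re (v k).
Proof. by rewrite /lc; case: (u k) => a b; case: (v k) => c d /=; ring. Qed.

Lemma Im_lc r u v k :
  complex.Im (lc r u v k) = complex.Im (u k) + r * complex.Im (v k).
Proof. by rewrite /lc; case: (u k) => a b; case: (v k) => c d /=; ring. Qed.

Lemma subf_lc u v : u \- v = lc (-1) u v.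
Proof. by apply/funext => k; rewrite /lc /= rmorphN1 mulN1r. Qed.

Lemma lc0 u v : lc 0 u v = u.
Proof. by apply/funext => k; rewrite /lc rmorph0 mul0r addr0. Qed.

Lemma lcuu u : lc (-1) u u = (fun=> 0).
Proof. by apply/funext => k; rewrite /lc rmorphN1 mulN1r subrr. Qed.

Lemma lc_lc s r u v u' v' :
  lc s (lc r u v) (lc r u' v') = lc r (lc s u u') (lc s v v').
Proof.
apply/funext => k; rewrite /lc !mulrDr !addrA; congr (_ + _); last exact: mulrCA.
by rewrite addrAC.
Qed.

Lemma rterm_ge0 u k : 0 <= rterm u u k.
Proof. by rewrite /rterm -!expr2 addr_ge0 ?sqr_ge0. Qed.

Lemma rtermC u v : rterm u v = rterm v u.
Proof. by apply/funext => k; rewrite /rterm; ring. Qed.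

Lemma rterm_lc r u v w k :
  rterm (lc r u v) w k = rterm u w k + r * rterm v w k.
Proof. by rewrite /rterm Re_lc Im_lc; ring. Qed.

Lemma normsq_series u : normsq u = (\sum_(0 <= k <oo) (rterm u u k)%:E)%E.
Proof. by apply: eq_eseriesr => k _; rewrite normc_sq /rterm -!expr2. Qed.

Lemma normsq_cvg u : cvgn (series (rterm u u)) -> normsq u = (sqn u)%:E.
Proof.
move=> cu; rewrite normsq_series /rdot -EFin_lim //.
by congr (limn _); apply/funext => n /=; rewrite /series /= sumEFin.
Qed.

Lemma ell2P u : ell2 u <-> cvgn (series (rterm u u)).
Proof.
split; rewrite /ell2 /=.
- by rewrite normsq_series => /nnseries_is_cvg; apply; exact: rterm_ge0.
- by move=> cu; rewrite normsq_cvg // ltry.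
Qed.

Lemma normsqE u : ell2 u -> normsq u = (sqn u)%:E.
Proof. by move=> /ell2P; exact: normsq_cvg. Qed.

Lemma rterm_lc_le r u v k : rterm (lc r u v) (lc r u v) k <=
  2 * rterm u u k + 2 * r ^+ 2 * rterm v v k.
Proof.
rewrite /rterm !Re_lc !Im_lc -subr_ge0.
set a := complex.Re (u k); set b := complex.Im (u k).
set c := complex.Re (v k); set d := complex.Im (v k).
have -> : 2 * (a * a + b * b) + 2 * r ^+ 2 * (c * c + d * d) -
  ((a + r * c) * (a + r * c) + (b + r * d) * (b + r * d)) =
  (a - r * c) ^+ 2 + (b - r * d) ^+ 2 by ring.
by rewrite addr_ge0 ?sqr_ge0.
Qed.

Lemma ell2_lc r u v : ell2 u -> ell2 v -> ell2 (lc r u v).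
Proof.
move=> /ell2P cu /ell2P cv; apply/ell2P.
apply: (@series_le_cvg _ _ (2 *: rterm u u + (2 * r ^+ 2) *: rterm v v)).
- exact: rterm_ge0.
- by move=> k; rewrite /= addr_ge0 // mulr_ge0 ?rterm_ge0 // mulr_ge0 ?sqr_ge0.
- exact: rterm_lc_le.
- by apply: is_cvg_seriesD; exact: is_cvg_seriesZ.
Qed.

Lemma rdot_cvg u v : ell2 u -> ell2 v ->
  series (rterm u v) @ \oo --> rdot u v.
Proof.
move=> /ell2P cu /ell2P cv; suff: cvgn (series (rterm u v)) by [].
apply: normed_cvg.
apply: (@series_le_cvg _ _ (fun k => rterm u u k + rterm v v k)).
- by move=> k /=.
- by move=> k; rewrite addr_ge0 // rterm_ge0.
- move=> k; rewrite ler_norml /rterm.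
  set a := complex.Re (u k); set b := complex.Im (u k).
  set c := complex.Re (v k); set d := complex.Im (v k).
  have := sqr_ge0 (a + c); have := sqr_ge0 (a - c).
  have := sqr_ge0 (b + d); have := sqr_ge0 (b - d).
  have := sqr_ge0 a; have := sqr_ge0 b; have := sqr_ge0 c; have := sqr_ge0 d.
  by move=> *; apply/andP; split; lra.
- exact: (is_cvg_seriesD cu cv).
Qed.

Lemma rdotC u v : rdot u v = rdot v u.
Proof. by rewrite /rdot rtermC. Qed.

Lemma rdot_lcl r u v w : ell2 u -> ell2 v -> ell2 w ->
  rdot (lc r u v) w = rdot u w + r * rdot v w.
Proof.
move=> lu lv lw; apply: cvg_lim => //.
have -> : series (rterm (lc r u v) w) =
    series (rterm u w) \+ r \*: series (rterm v w).
  apply/funext => n; rewrite /series /= scaler_sumr -big_split /=.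
  by apply: eq_bigr => k _; rewrite rterm_lc.
by apply: cvgD; [exact: rdot_cvg|apply: cvgZl_tmp; exact: rdot_cvg].
Qed.

Lemma rdot_lcr r u v w : ell2 u -> ell2 v -> ell2 w ->
  rdot w (lc r u v) = rdot w u + r * rdot w v.
Proof. by move=> lu lv lw; rewrite rdotC rdot_lcl // !(rdotC w). Qed.

Lemma sqn_ge_term u k : ell2 u -> rterm u u k <= sqn u.
Proof.
move=> lu; apply: (@le_trans _ _ (series (rterm u u) k.+1)).
  by rewrite /series /= big_nat_recr //= lerDr sumr_ge0 // => i _; apply: rterm_ge0.
apply: nondecreasing_cvgn_le; last by exact/ell2P.
by apply: nondecreasing_series => n _ _; exact: rterm_ge0.
Qed.

Lemma sqn_ge0 u : ell2 u -> 0 <= sqn u.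
Proof. by move=> lu; exact: le_trans (rterm_ge0 u 0) (sqn_ge_term 0 lu). Qed.

Lemma sqn_eq0 u : ell2 u -> sqn u = 0 -> u = (fun=> 0).
Proof.
move=> lu u0; apply/funext => k; have := sqn_ge_term k lu; rewrite u0 /rterm.
case: (u k) => a b /=; have := sqr_ge0 a; have := sqr_ge0 b.
rewrite !expr2 => b0 a0 ab0.
have a2 : a ^+ 2 = 0 by lra.
have b2 : b ^+ 2 = 0 by lra.
by move/eqP : a2; move/eqP : b2; rewrite !sqrf_eq0 => /eqP -> /eqP ->.
Qed.

Lemma sqn_lc r u v : ell2 u -> ell2 v ->
  sqn (lc r u v) = sqn u + r * (2 * rdot u v) + r ^+ 2 * sqn v.
Proof.
move=> lu lv; rewrite rdot_lcl ?rdot_lcr //; try exact: ell2_lc.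
by rewrite (rdotC v u); ring.
Qed.

Lemma sqdE u v : ell2 u -> ell2 v -> sqd u v = sqn u - 2 * rdot u v + sqn v.
Proof. by move=> lu lv; rewrite /sqd sqn_lc //; ring. Qed.

Lemma sqd_ge0 u v : ell2 u -> ell2 v -> 0 <= sqd u v.
Proof. by move=> lu lv; rewrite /sqd sqn_ge0 //; exact: ell2_lc. Qed.

Lemma sqdC u v : ell2 u -> ell2 v -> sqd u v = sqd v u.
Proof. by move=> lu lv; rewrite !sqdE // (rdotC v u); ring. Qed.

Lemma sqd_eq0 u v : ell2 u -> ell2 v -> sqd u v = 0 -> u = v.
Proof.
move=> lu lv /sqn_eq0 => /(_ (ell2_lc _ lu lv)) h; apply/funext => k.
have := congr1 (fun f => f k) h; rewrite /lc rmorphN1 mulN1r => /eqP.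
by rewrite subr_eq0 => /eqP.
Qed.

Lemma CauchySchwarz u v : ell2 u -> ell2 v ->
  rdot u v ^+ 2 <= sqn u * sqn v.
Proof.
move=> lu lv; apply: discr_le; first exact: sqn_ge0.
by move=> t; rewrite -sqn_lc // sqn_ge0 //; exact: ell2_lc.
Qed.

Lemma norm_rdot_le u v : ell2 u -> ell2 v ->
  `|rdot u v| <= Num.sqrt (sqn u) * Num.sqrt (sqn v).
Proof.
move=> lu lv; rewrite -sqrtrM ?sqn_ge0 // -sqrtr_sqr.
by apply: ler_wsqrtr; exact: CauchySchwarz.
Qed.

Lemma sqn_lc_le r u v : ell2 u -> ell2 v ->
  sqn (lc r u v) <= 2 * sqn u + 2 * r ^+ 2 * sqn v.
Proof.
move=> lu lv.
have := sqn_ge0 (ell2_lc (- r) lu lv); rewrite !sqn_lc //; lra.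
Qed.

Lemma sqd_triangle u v w : ell2 u -> ell2 v -> ell2 w ->
  sqd u w <= 2 * sqd u v + 2 * sqd v w.
Proof.
move=> lu lv lw; have -> : sqd u w = sqn (lc 1 (lc (-1) u v) (lc (-1) v w)).
  suff : lc (-1) u w = lc 1 (lc (-1) u v) (lc (-1) v w).
    by rewrite /sqd => ->.
  by apply/funext => k; rewrite /lc rmorphN1 rmorph1 !mulN1r mul1r addrA subrK.
have := sqn_lc_le 1 (ell2_lc (-1) lu lv) (ell2_lc (-1) lv lw).
by rewrite /sqd expr1n mulr1.
Qed.

(** * Convergence in the norm of l^2 *)

Definition l2cvg (un : nat -> nat -> R[i]) u : Prop :=
  sqd (un n) u @[n --> \oo] --> 0.

Lemma ell2_cvgE un u : (forall n, ell2 (un n)) -> ell2 u ->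
  ell2_cvg un u <-> l2cvg un u.
Proof.
move=> lun lu; rewrite /ell2_cvg /l2cvg.
have -> : (fun n => normsq ((un n) \- u)) = (fun n => (sqd (un n) u)%:E).
  by apply/funext => n; rewrite subf_lc normsqE //; exact: ell2_lc.
by split=> [/fine_cvg //|h]; apply: cvg_EFin => //; exact: nearW.
Qed.

Lemma l2cvg_cst u : l2cvg (fun=> u) u.
Proof.
rewrite /l2cvg; under eq_fun do rewrite /sqd lcuu.
suff -> : rdot (fun=> 0 : R[i]) (fun=> 0) = 0 by exact: cvg_cst.
apply: cvg_lim => //; suff -> : series (rterm (fun=> 0 : R[i]) (fun=> 0)) = fun=> 0.
  exact: cvg_cst.
apply/funext => n; rewrite /series /= big1 // => i _.
by rewrite /rterm /= !mulr0 addr0.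
Qed.

Lemma rdot_cvg_l2 un vn u v : (forall n, ell2 (un n)) -> (forall n, ell2 (vn n)) ->
  ell2 u -> ell2 v -> l2cvg un u -> l2cvg vn v ->
  rdot (un n) (vn n) @[n --> \oo] --> rdot u v.
Proof.
move=> lun lvn lu lv cu cv.
pose s (x : R) := Num.sqrt x.
have su : s (sqd (un n) u) @[n --> \oo] --> 0 by exact: cvg_sqrt0.
have sv : s (sqd (vn n) v) @[n --> \oo] --> 0 by exact: cvg_sqrt0.
have bnd n : `|rdot (un n) (vn n) - rdot u v| <=
    s (sqd (un n) u) * s (sqd (vn n) v) + s (sqd (un n) u) * s (sqn v) +
    s (sqn u) * s (sqd (vn n) v).
  (* Bilinear expansion around the limit: every term contains an error [un n - u] or [vn n - v]. *)
  have -> : rdot (un n) (vn n) - rdot u v =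
      rdot (lc (-1) (un n) u) (lc (-1) (vn n) v) + rdot (lc (-1) (un n) u) v +
      rdot u (lc (-1) (vn n) v).
    by rewrite !rdot_lcl ?rdot_lcr //; try exact: ell2_lc; ring.
  apply: le_trans (ler_normD _ _) _; apply: lerD; last first.
    by apply: norm_rdot_le => //; exact: ell2_lc.
  apply: le_trans (ler_normD _ _) _; apply: lerD.
    by apply: norm_rdot_le; exact: ell2_lc.
  by apply: norm_rdot_le => //; exact: ell2_lc.
apply/subr_cvg0/norm_cvg0P; apply: cvg0_le.
  by move=> n; rewrite normr_ge0; exact: bnd.
rewrite -[X in _ --> X](_ : 0 * 0 + 0 * s (sqn v) + s (sqn u) * 0 = 0); last by ring.
apply: cvgD; first by apply: cvgD; [exact: cvgM|apply: cvgM => //; exact: cvg_cst].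
by apply: cvgM => //; exact: cvg_cst.
Qed.

Lemma l2cvg_lc r un vn u v : (forall n, ell2 (un n)) -> (forall n, ell2 (vn n)) ->
  ell2 u -> ell2 v -> l2cvg un u -> l2cvg vn v ->
  l2cvg (fun n => lc r (un n) (vn n)) (lc r u v).
Proof.
move=> lun lvn lu lv cu cv; rewrite /l2cvg.
apply: (@cvg0_le _ _ (fun n => 2 * sqd (un n) u + 2 * r ^+ 2 * sqd (vn n) v)).
- move=> n; rewrite sqd_ge0 /=; try exact: ell2_lc.
  have -> : sqd (lc r (un n) (vn n)) (lc r u v) =
      sqn (lc r (lc (-1) (un n) u) (lc (-1) (vn n) v)).
    by rewrite /sqd lc_lc.
  by apply: sqn_lc_le; exact: ell2_lc.
- rewrite -[X in _ --> X](_ : 2 * 0 + 2 * r ^+ 2 * 0 = 0); last by ring.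
  by apply: cvgD; apply: cvgM => //; exact: cvg_cst.
Qed.

Lemma l2cvg_uniq un u v : (forall n, ell2 (un n)) -> ell2 u -> ell2 v ->
  l2cvg un u -> l2cvg un v -> u = v.
Proof.
move=> lun lu lv cu cv; apply: sqd_eq0 => //.
suff : sqd u v @[n --> \oo] --> 0 by move/(cvg_unique _ (cvg_cst _)) => ->.
apply: (@cvg0_le _ _ (fun n => 2 * sqd (un n) u + 2 * sqd (un n) v)).
  by move=> n; rewrite sqd_ge0 //= (sqdC (lun n) lu) sqd_triangle.
rewrite -[X in _ --> X](_ : 2 * 0 + 2 * 0 = 0); last by ring.
by apply: cvgD; apply: cvgM => //; exact: cvg_cst.
Qed.

Lemma l2cvg_sub (phi : nat -> nat) un u : (forall n, n <= phi n)%N ->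
  l2cvg un u -> l2cvg (un \o phi) u.
Proof. by move=> /cvg_ge_id phioo cu; exact: cvg_comp phioo cu. Qed.

Lemma l2cvg_coord un u k : (forall n, ell2 (un n)) -> ell2 u -> l2cvg un u ->
  complex.Re (un n k) @[n --> \oo] --> complex.Re (u k) /\
  complex.Im (un n k) @[n --> \oo] --> complex.Im (u k).
Proof.
move=> lun lu /cvg_sqrt0 cu.
have le n := sqn_ge_term k (ell2_lc (-1) (lun n) lu).
split; apply/subr_cvg0/norm_cvg0P; (apply: cvg0_le; last exact: cu);
    move=> n; rewrite normr_ge0 -sqrtr_sqr /=; apply: ler_wsqrtr;
    apply: le_trans (le n); rewrite /rterm Re_lc Im_lc !mulN1r -!expr2.
- by rewrite lerDl sqr_ge0.
- by rewrite lerDr sqr_ge0.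
Qed.

(** * Finitely supported vectors *)

Lemma ell2_supp n u : (forall k, (n <= k)%N -> u k = 0) -> ell2 u.
Proof.
move=> un0; apply/ell2P; apply/cvg_ex; exists (series (rterm u u) n).
apply: cvg_near_cst; exists n => // m /= nm; rewrite /series /=.
rewrite (big_cat_nat (n := n)) //= -[RHS]addr0; congr (_ + _).
rewrite big_nat_cond big1 //.
by move=> k /andP[/andP[nk _] _]; rewrite /rterm un0 //= !mulr0 addr0.
Qed.

Lemma rdot_supp n u v : (forall k, (n <= k)%N -> v k = 0) ->
  rdot u v = \sum_(0 <= k < n) rterm u v k.
Proof.
move=> un0; apply: cvg_lim => //.
apply: cvg_near_cst; exists n => // m /= nm; rewrite /series /=.
rewrite (big_cat_nat (n := n)) //= -[RHS]addr0; congr (_ + _).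
rewrite big_nat_cond big1 //.
by move=> k /andP[/andP[nk _] _]; rewrite /rterm un0 //= !mulr0 addr0.
Qed.

Lemma ell2_0 : ell2 (fun=> 0 : R[i]).
Proof. exact: (@ell2_supp 0). Qed.

Lemma rdot0r u : rdot u (fun=> 0) = 0.
Proof. by rewrite (rdot_supp (n := 0%N)) ?big_nil. Qed.

Lemma rdot_lc0 r u v : ell2 u -> ell2 v ->
  rdot (lc r (fun=> 0) u) v = r * rdot u v.
Proof.
move=> lu lv; rewrite rdot_lcl //; last exact: ell2_0.
by rewrite (rdotC (fun=> 0)) rdot0r add0r.
Qed.

Lemma sqn_lc0 r u : ell2 u -> sqn (lc r (fun=> 0) u) = r ^+ 2 * sqn u.
Proof.
move=> lu; rewrite sqn_lc //; last exact: ell2_0.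
by rewrite (rdotC (fun=> 0) u) !rdot0r; ring.
Qed.

Lemma ell2_lc0 r u : ell2 u -> ell2 (lc r (fun=> 0) u).
Proof. by apply: ell2_lc; exact: ell2_0. Qed.

End Ell2.
Notation sqn u := (rdot u u).

(** * The Jacobi operator *)

Section JacobiForm.
Variables (R : realType) (a b : nat -> R).
Implicit Types (u v w : nat -> R[i]) (r : R).

Local Notation S := (jacobi_action a b).
Local Notation J := (jacobi a b).

Definition supp n u := forall k, (n <= k)%N -> u k = 0.

Lemma supp_ell2 n u : supp n u -> ell2 u.
Proof. exact: ell2_supp. Qed.

Lemma supp_le m n u : supp m u -> (m <= n)%N -> supp n u.
Proof. by move=> um mn k nk; apply: um; exact: leq_trans nk. Qed.

Lemma supp_lc r n u v : supp n u -> supp n v -> supp n (lc r u v).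
Proof. by move=> un vn k nk; rewrite /lc un // vn // mulr0 addr0. Qed.

Lemma Re_action u k : complex.Re (S u k) =
  (if k is m.+1 then a m * complex.Re (u m) else 0) + b k * complex.Re (u k)
    + a k * complex.Re (u k.+1).
Proof.
rewrite /jacobi_action; case: k => [|k].
  by case: (u 0%N) => ? ?; case: (u 1%N) => ? ? /=; ring.
by case: (u k) => ? ?; case: (u k.+1) => ? ?; case: (u k.+2) => ? ? /=; ring.
Qed.

Lemma Im_action u k : complex.Im (S u k) =
  (if k is m.+1 then a m * complex.Im (u m) else 0) + b k * complex.Im (u k)
    + a k * complex.Im (u k.+1).
Proof.
rewrite /jacobi_action; case: k => [|k].
  by case: (u 0%N) => ? ?; case: (u 1%N) => ? ? /=; ring.
by case: (u k) => ? ?; case: (u k.+1) => ? ?; case: (u k.+2) => ? ? /=; ring.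
Qed.

Lemma complex_ext (z z' : R[i]) :
  complex.Re z = complex.Re z' -> complex.Im z = complex.Im z' -> z = z'.
Proof. by case: z; case: z' => /= ? ? ? ? -> ->. Qed.

Lemma action_lc r u v : S (lc r u v) = lc r (S u) (S v).
Proof.
apply/funext => k; apply: complex_ext.
  by rewrite Re_lc !Re_action; case: k => [|k]; rewrite !Re_lc; ring.
by rewrite Im_lc !Im_action; case: k => [|k]; rewrite !Im_lc; ring.
Qed.

Lemma supp_action n u : supp n u -> supp n.+1 (S u).
Proof.
move=> un [//|k]; rewrite ltnS => nk; rewrite /jacobi_action !un ?mulr0 ?addr0 //.
- exact: leqW (leqW nk).
- exact: leqW.
Qed.

Lemma jacobi_supp n u : supp n u -> J (u, S u).
Proof.
move=> un; have lu := supp_ell2 un; have lSu := supp_ell2 (supp_action un).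
split => //=; exists (fun=> u), (fun=> S u).
split; first by move=> _; split => //; exists n.
- by apply/ell2_cvgE => //; exact: l2cvg_cst.
- by apply/ell2_cvgE => //; exact: l2cvg_cst.
Qed.

Lemma jacobiP u u' : J (u, u') -> [/\ ell2 u, ell2 u' &
  exists un : nat -> nat -> R[i], [/\ forall n, exists m, supp m (un n),
    l2cvg un u & l2cvg (S \o un) u']].
Proof.
case=> /= lu lu' [un [vn [Jn cu cv]]]; split => //; exists un.
have fs n : exists m, supp m (un n) by have [] := Jn n.
have vE : vn = S \o un by apply/funext => n; have [] := Jn n.
split => //.
- by apply/ell2_cvgE => // n; have [m /supp_ell2] := fs n.
- rewrite -vE; apply/ell2_cvgE => // n.
  by rewrite vE /=; have [m /supp_action/supp_ell2] := fs n.
Qed.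

Lemma jacobi_lc r u u' v v' : J (u, u') -> J (v, v') -> J (lc r u v, lc r u' v').
Proof.
move=> /jacobiP[lu lu' [un [fu cu cu']]] /jacobiP[lv lv' [vn [fv cv cv']]].
have eu n : ell2 (un n) by have [m /supp_ell2] := fu n.
have ev n : ell2 (vn n) by have [m /supp_ell2] := fv n.
have eSu n : ell2 (S (un n)) by have [m /supp_action/supp_ell2] := fu n.
have eSv n : ell2 (S (vn n)) by have [m /supp_action/supp_ell2] := fv n.
split => /=; try exact: ell2_lc.
exists (fun n => lc r (un n) (vn n)), (fun n => lc r (S (un n)) (S (vn n))).
split.
- move=> n /=; split; last by rewrite action_lc.
  have [m um] := fu n; have [p vp] := fv n; exists (maxn m p).
  by apply: supp_lc; [apply: (supp_le um)|apply: (supp_le vp)];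
    rewrite ?leq_maxl ?leq_maxr.
- by apply/ell2_cvgE => [n||]; [exact: ell2_lc|exact: ell2_lc|exact: l2cvg_lc].
- apply/ell2_cvgE => [n||]; [exact: ell2_lc|exact: ell2_lc|].
  exact: (@l2cvg_lc _ _ (S \o un) (S \o vn)).
Qed.

(** Discrete Green identity: the off-diagonal terms telescope and only a boundary term of Wronskian
    type at the cut [n] survives. *)
Lemma green u v n : \sum_(0 <= k < n.+1) rterm (S u) v k =
  \sum_(0 <= k < n.+1) rterm u (S v) k +
  a n * (complex.Re (u n.+1) * complex.Re (v n) + complex.Im (u n.+1) * complex.Im (v n)
    - complex.Re (u n) * complex.Re (v n.+1) - complex.Im (u n) * complex.Im (v n.+1)).
Proof.
elim: n => [|n ih].
  by rewrite !big_nat1 /rterm !Re_action !Im_action; ring.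
rewrite big_nat_recr //= ih [in RHS]big_nat_recr //= -!addrA; congr (_ + _).
by rewrite /rterm !Re_action !Im_action; ring.
Qed.

Lemma action_sym n u v : supp n u -> supp n v -> rdot (S u) v = rdot u (S v).
Proof.
(* [S v] may reach index [n], so the sums run up to [n.+1]; the boundary term there contains only
   vanishing entries. *)
move=> un vn; rewrite (rdot_supp (n := n.+1)); last exact: (supp_le vn).
rewrite [RHS](rdot_supp (n := n.+1)); last exact: supp_action.
by rewrite green (un n) // (un n.+1) // /=; ring.
Qed.

Lemma jacobi_sym u u' v v' : J (u, u') -> J (v, v') -> rdot u' v = rdot u v'.
Proof.
move=> /jacobiP[lu lu' [un [fu cu cu']]] /jacobiP[lv lv' [vn [fv cv cv']]].
have eu n : ell2 (un n) by have [m /supp_ell2] := fu n.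
have ev n : ell2 (vn n) by have [m /supp_ell2] := fv n.
have eSu n : ell2 (S (un n)) by have [m /supp_action/supp_ell2] := fu n.
have eSv n : ell2 (S (vn n)) by have [m /supp_action/supp_ell2] := fv n.
have c1 := rdot_cvg_l2 eSu ev lu' lv cu' cv.
have c2 := rdot_cvg_l2 eu eSv lu lv' cu cv'.
apply: cvg_unique c1 _ => //; apply: cvg_trans c2; apply: near_eq_cvg.
apply: nearW => n /=; have [m um] := fu n; have [p vp] := fv n.
by rewrite (@action_sym (maxn m p)) //;
  [apply: (supp_le um)|apply: (supp_le vp)]; rewrite ?leq_maxl ?leq_maxr.
Qed.

Hypothesis J_pos : op_positive J.

Lemma jacobi_ge0 u u' : J (u, u') -> 0 <= rdot u' u.
Proof. by move=> /J_pos; rewrite lecE => /andP[_]; rewrite Re_dot. Qed.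

Lemma jacobi_form_lc r u u' v v' : J (u, u') -> J (v, v') ->
  rdot (lc r u' v') (lc r u v) =
  rdot u' u + r * (2 * rdot u' v) + r ^+ 2 * rdot v' v.
Proof.
move=> Ju Jv; have [lu lu' _] := jacobiP Ju; have [lv lv' _] := jacobiP Jv.
rewrite rdot_lcl ?rdot_lcr //; try exact: ell2_lc.
by rewrite (jacobi_sym Jv Ju) (rdotC v u'); ring.
Qed.

Lemma jacobi_CS u u' v v' : J (u, u') -> J (v, v') ->
  rdot u' v ^+ 2 <= rdot u' u * rdot v' v.
Proof.
move=> Ju Jv; apply: discr_le; first exact: jacobi_ge0.
by move=> t; rewrite -jacobi_form_lc //; exact/jacobi_ge0/jacobi_lc.
Qed.

(** Parallelogram argument: the form is also nonnegative at the combination with coefficient [- r],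
    and the mixed terms of the two expansions cancel. *)
Lemma jacobi_form_lc_le r u u' v v' : J (u, u') -> J (v, v') ->
  rdot (lc r u' v') (lc r u v) <= 2 * rdot u' u + 2 * r ^+ 2 * rdot v' v.
Proof.
move=> Ju Jv; have := jacobi_ge0 (jacobi_lc (- r) Ju Jv).
by rewrite !jacobi_form_lc //; lra.
Qed.

End JacobiForm.

(** * The Friedrichs form *)

Section FriedrichsForm.
Variables (R : realType) (a b : nat -> R).
Implicit Types (u v w h g : nat -> R[i]) (un vn wn : nat -> nat -> R[i]).

Local Notation S := (jacobi_action a b).
Local Notation J := (jacobi a b).
Hypothesis J_pos : op_positive J.

(** The Cauchy condition of [form_seq] with the real part in place of the modulus, hence implied by
    it. *)
Definition form_cauchy un un' : Prop := forall eps : R, 0 < eps ->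
  exists N, forall n m, (N <= n)%N -> (N <= m)%N ->
    rdot (lc (-1) (un' n) (un' m)) (lc (-1) (un n) (un m)) < eps.

Definition form_approx un un' u : Prop :=
  [/\ ell2 u, forall n, J (un n, un' n), l2cvg un u & form_cauchy un un'].

Lemma jacobi_ell2 u u' : J (u, u') -> ell2 u /\ ell2 u'.
Proof. by move=> /jacobiP[]. Qed.

Lemma form_seq_approx un un' u : form_seq J un un' u -> form_approx un un' u.
Proof.
move=> [lu Ju cu fc]; split => //.
  by apply/ell2_cvgE => // n; have [] := jacobi_ell2 (Ju n).
move=> e /fc[N hN]; exists N => n m Nn Nm.
apply: le_lt_trans (hN n m Nn Nm); rewrite -!subf_lc -Re_dot.
exact: le_trans (ler_norm _) (normc_ge_absRe _).
Qed.

Lemma form_approx_lc r un un' u vn vn' v :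
  form_approx un un' u -> form_approx vn vn' v ->
  form_approx (fun n => lc r (un n) (vn n)) (fun n => lc r (un' n) (vn' n)) (lc r u v).
Proof.
move=> [lu Ju cu fu] [lv Jv cv fv]; split.
- exact: ell2_lc.
- by move=> n; exact: jacobi_lc.
- apply: l2cvg_lc => // n; first by have [] := jacobi_ell2 (Ju n).
  by have [] := jacobi_ell2 (Jv n).
- move=> e e0; pose d := e / (2 * (1 + r ^+ 2)).
  have r0 := sqr_ge0 r.
  have d0 : 0 < d by rewrite divr_gt0 // mulr_gt0 //; lra.
  have [N hN] := fu _ d0; have [M hM] := fv _ d0.
  exists (maxn N M) => n m; rewrite !geq_max => /andP[Nn Mn] /andP[Nm Mm].
  rewrite lc_lc [X in rdot _ X]lc_lc; apply: le_lt_trans.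
    by apply: (jacobi_form_lc_le J_pos); exact: jacobi_lc.
  have -> : e = 2 * d + 2 * r ^+ 2 * d.
    rewrite /d; field; lra.
  have h1 := hN _ _ Nn Nm; have h2 := hM _ _ Mn Mm.
  have := ler_wpM2l r0 (ltW h2); lra.
Qed.

Lemma form_approx_cst u u' : J (u, u') -> form_approx (fun=> u) (fun=> u') u.
Proof.
move=> Ju; have [lu _] := jacobi_ell2 Ju; split => //; first exact: l2cvg_cst.
move=> e e0; exists 0%N => n m _ _; rewrite lcuu (rdot_supp (n := 0%N)) ?big_nil //.
by move=> k _; rewrite lcuu.
Qed.

(* Closability: [t(w_n) <= t(w_n - w_m) + 2 <J w_n, w_m>], and the last term
   vanishes as m tends to infinity. *)
Lemma form_approx0 wn wn' : form_approx wn wn' (fun=> 0) ->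
  rdot (wn' n) (wn n) @[n --> \oo] --> 0.
Proof.
move=> [l0 Jw cw fw]; apply/cvgrPdist_le => e e0.
have [N hN] := fw e e0; exists N => // n /= Nn.
have t0 : 0 <= rdot (wn' n) (wn n) by exact: (jacobi_ge0 J_pos).
rewrite sub0r normrN ger0_norm //.
have [ln ln'] := jacobi_ell2 (Jw n).
have lw m : ell2 (wn m) by have [] := jacobi_ell2 (Jw m).
have c : e + 2 * rdot (wn' n) (wn m) @[m --> \oo] --> e.
  rewrite -[X in _ --> X](_ : e + 2 * 0 = e); last by ring.
  apply: cvgD; first exact: cvg_cst.
  apply: cvgM; first exact: cvg_cst.
  rewrite -(rdot0r (wn' n)); apply: rdot_cvg_l2 => //; exact: l2cvg_cst.
apply: (cvgr_to_ge c); exists N => // m /= Nm.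
have := hN n m Nn Nm; rewrite (jacobi_form_lc (-1) (Jw n) (Jw m)).
have := jacobi_ge0 J_pos (Jw m); lra.
Qed.

Lemma form_approx_bounded un un' u : form_approx un un' u ->
  exists C, \forall n \near \oo, rdot (un' n) (un n) <= C.
Proof.
move=> [lu Ju cu fu]; have [N hN] := fu 1 ltr01.
exists (2 * 1 + 2 * rdot (un' N) (un N)); exists N => // n /= Nn.
have h := hN n N Nn (leqnn N).
have := jacobi_form_lc_le J_pos 1 (jacobi_lc (-1) (Ju n) (Ju N)) (Ju N).
have -> : lc 1 (lc (-1) (un n) (un N)) (un N) = un n.
  by apply/funext => k; rewrite /lc rmorph1 rmorphN1 mulN1r mul1r subrK.
have -> : lc 1 (lc (-1) (un' n) (un' N)) (un' N) = un' n.
  by apply/funext => k; rewrite /lc rmorph1 rmorphN1 mulN1r mul1r subrK.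
by rewrite expr1n mulr1; lra.
Qed.

(** Cauchy-Schwarz for the form: one factor stays bounded, the other tends to 0 by closability. *)
Lemma form_approx_null un un' u wn wn' : form_approx un un' u ->
  form_approx wn wn' (fun=> 0) -> rdot (un' n) (wn n) @[n --> \oo] --> 0.
Proof.
move=> au aw; have [C hC] := form_approx_bounded au.
have := form_approx0 aw; case: au => lu Ju _ _; case: aw => _ Jw _ _ c0.
have {}c0 : C * rdot (wn' n) (wn n) @[n --> \oo] --> 0.
  rewrite -[X in _ --> X](mulr0 C); apply: cvgM => //; exact: cvg_cst.
apply/norm_cvg0P; apply: squeeze_cvgr (cvg_cst 0) (cvg_sqrt0 c0).
apply: filterS hC => n hn; rewrite normr_ge0 -sqrtr_sqr /=; apply: ler_wsqrtr.
apply: le_trans (jacobi_CS J_pos (Ju n) (Jw n)) _.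
by apply: ler_wpM2r => //; exact: (jacobi_ge0 J_pos).
Qed.

(** Two approximations of the same vector differ by an approximation of 0, which [form_approx_null]
    discards; so the closed form depends on the limit vectors only. *)
Lemma form_approx_uniq un un' pn pn' u vn vn' qn qn' v (c : R) :
  form_approx un un' u -> form_approx pn pn' u ->
  form_approx vn vn' v -> form_approx qn qn' v ->
  rdot (un' n) (vn n) @[n --> \oo] --> c ->
  rdot (pn' n) (qn n) @[n --> \oo] --> c.
Proof.
move=> au ap av aq cuv.
have := form_approx_lc (-1) ap au; rewrite lcuu => apu.
have := form_approx_lc (-1) aq av; rewrite lcuu => aqv.
have c1 := form_approx_null av apu.
have c2 := form_approx_null ap aqv.
have -> : (fun n => rdot (pn' n) (qn n)) = (fun n =>
    rdot (vn' n) (lc (-1) (pn n) (un n)) + rdot (pn' n) (lc (-1) (qn n) (vn n))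
    + rdot (un' n) (vn n)).
  apply/funext => n.
  case: au => _ /(_ n) Ju _ _; case: ap => _ /(_ n) Jp _ _.
  case: av => _ /(_ n) Jv _ _; case: aq => _ /(_ n) Jq _ _.
  have [? ?] := jacobi_ell2 Ju; have [? ?] := jacobi_ell2 Jv.
  have [? ?] := jacobi_ell2 Jp; have [? ?] := jacobi_ell2 Jq.
  rewrite !rdot_lcr // (jacobi_sym Jv Jp) (jacobi_sym Jv Ju) !(rdotC (vn n)).
  by ring.
rewrite -[X in _ --> X](_ : 0 + 0 + c = c); last by ring.
by apply: cvgD => //; exact: cvgD.
Qed.

Lemma closed_form_cvg u v c un un' vn vn' : closed_form J u v c ->
  form_approx un un' u -> form_approx vn vn' v ->
  rdot (un' n) (vn n) @[n --> \oo] --> complex.Re c.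
Proof.
move=> [pn [pn' [qn [qn' [/form_seq_approx ap /form_seq_approx aq cc]]]]] au av.
apply: (form_approx_uniq ap au aq av).
apply/subr_cvg0/norm_cvg0P; apply: cvg0_le cc => n; rewrite normr_ge0 /=.
apply: le_trans (normc_ge_absRe _); rewrite -Re_dot.
by case: (dot _ _) => x y; case: c.
Qed.

(** The defining property of the Friedrichs extension for arbitrary approximating sequences, which
    can then be chosen to suit each use. *)
Lemma friedrichsP v h : friedrichs J (v, h) ->
  [/\ ell2 v, ell2 h, closed_form_domain J v &
  forall w wn wn' vn vn', closed_form_domain J w -> form_approx wn wn' w ->
    form_approx vn vn' v -> rdot (vn' n) (wn n) @[n --> \oo] --> rdot h w].
Proof.
case=> /= dv lh cf; split => //; first by case: dv => ? [? []].
move=> w wn wn' vn vn' dw aw av; rewrite -Re_dot.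
exact: closed_form_cvg (cf w dw) av aw.
Qed.

Lemma friedrichs_ell2 v h : friedrichs J (v, h) -> ell2 v /\ ell2 h.
Proof. by move=> /friedrichsP[]. Qed.

Lemma dot0r u : dot u (fun=> 0) = 0.
Proof.
rewrite /dot; have e (f : R[i] -> R) : f 0 = 0 ->
    limn (series (fun k => f (u k * (0 : R[i])^*%C))) = 0.
  move=> f0; apply: cvg_lim => //.
  suff -> : series (fun k => f (u k * (0 : R[i])^*%C)) = fun=> 0 by exact: cvg_cst.
  by apply/funext => n; apply: big1 => k _; rewrite conjc0 mulr0.
by rewrite (e (@complex.Re R)) // (e (@complex.Im R)).
Qed.

Lemma supp_closed_form_domain n u : supp n u -> closed_form_domain J u.
Proof.
move=> /(jacobi_supp a b) Ju; have [lu _] := jacobi_ell2 Ju.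
exists (fun=> u), (fun=> S u); split => //.
  by apply/ell2_cvgE => //; exact: l2cvg_cst.
move=> e e0; exists 0%N => n' m' _ _.
by rewrite [u \- u]subf_lc lcuu dot0r Normc.normc0.
Qed.

(** A finitely supported vector approximates itself in the form, so the weak equation can be tested
    on it; symmetry then moves the matrix onto the test vector. *)
Lemma friedrichs_supp v h n u : friedrichs J (v, h) -> supp n u ->
  rdot v (S u) = rdot h u.
Proof.
move=> /friedrichsP[lv lh dv fv] un; have Ju := jacobi_supp a b un.
have [vn [vn' /form_seq_approx av]] := dv.
have c := fv _ _ _ _ _ (supp_closed_form_domain un) (form_approx_cst Ju) av.
have [lu lSu] := jacobi_ell2 Ju; case: av => _ Jv cv _.
apply: cvg_unique c => //.
have lvn k : ell2 (vn k) by have [] := jacobi_ell2 (Jv k).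
have -> : (fun n => rdot (vn' n) u) = (fun n => rdot (vn n) (S u)).
  by apply/funext => k; exact: jacobi_sym (Jv k) Ju.
by apply: rdot_cvg_l2 => //; exact: l2cvg_cst.
Qed.

Lemma friedrichs_sym v h w g : friedrichs J (v, h) -> friedrichs J (w, g) ->
  rdot h w = rdot v g.
Proof.
move=> /friedrichsP[lv lh dv fv] /friedrichsP[lw lg dw fw].
have [vn [vn' /form_seq_approx av]] := dv.
have [wn [wn' /form_seq_approx aw]] := dw.
have c1 := fv _ _ _ _ _ dw aw av; have c2 := fw _ _ _ _ _ dv av aw.
apply: cvg_unique c1 _ => //; rewrite (rdotC v) .
suff -> : (fun n => rdot (vn' n) (wn n)) = (fun n => rdot (wn' n) (vn n)) by [].
apply/funext => n; case: av => _ /(_ n) Jv _ _; case: aw => _ /(_ n) Jw _ _.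
by rewrite (jacobi_sym Jv Jw) rdotC.
Qed.

(** Finitely supported vectors form a core. Two approximations are composed: vectors in the domain
    of [J] approach [v] in the form, and finitely supported ones approach these in the graph of
    [J]. *)
Lemma friedrichs_approx v h (e : R) : friedrichs J (v, h) -> 0 < e ->
  exists n u, [/\ supp n u, sqd u v < e & `|rdot (S u) u - rdot h v| < e].
Proof.
move=> /friedrichsP[lv lh dv fv] e0; have e4 : 0 < e / 4 by lra.
have [vn [vn' /form_seq_approx av]] := dv.
have := fv _ _ _ _ _ dv av av; case: av => _ Jv cv _.
move=> /cvgrPdist_lt/(_ _ e4)[N1 _ h1].
have [N2 _ h2] := (cvgrPdist_lt _ _).1 cv _ e4.
pose n := maxn N1 N2; have {}h1 := h1 n (leq_maxl _ _).
have {}h2 := h2 n (leq_maxr _ _).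
have /jacobiP[ln ln' [un [fu cu cu']]] := Jv n.
have eu k : ell2 (un k) by have [m /supp_ell2] := fu k.
have eSu k : ell2 (S (un k)) by have [m /supp_action/supp_ell2] := fu k.
have [K1 _ k1] := (cvgrPdist_lt _ _).1 (rdot_cvg_l2 eSu eu ln' ln cu' cu) _ e4.
have [K2 _ k2] := (cvgrPdist_lt _ _).1 cu _ e4.
pose k := maxn K1 K2; have {}k1 := k1 k (leq_maxl _ _).
have {}k2 := k2 k (leq_maxr _ _).
have [m um] := fu k; exists m, (un k); split => //.
- have := sqd_triangle (eu k) ln lv.
  move: h2 k2; rewrite !sub0r !normrN !ger0_norm ?sqd_ge0 //; lra.
- rewrite distrC (le_lt_trans (ler_distD (rdot (vn' n) (vn n)) _ _)) //.
  move: h1 k1; rewrite /=; lra.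
Qed.

End FriedrichsForm.

(** * Galerkin approximation of the inverse *)

Section Galerkin.
Variables (R : realType) (a b : nat -> R).
Implicit Types (u v w h g y z : nat -> R[i]) (hn yn : nat -> nat -> R[i]).

Local Notation S := (jacobi_action a b).
Local Notation J := (jacobi a b).
Local Notation T := (friedrichs J).

(* Galerkin equation: the [n]-th truncation of [J] maps [y] to that of [h]. *)
Definition galerkin n h y := supp n y /\ forall k, (k < n)%N -> S y k = h k.

Lemma galerkin_rdot n h y u : galerkin n h y -> supp n u ->
  rdot (S y) u = rdot h u.
Proof.
move=> [_ yh] un; rewrite !(rdot_supp (n := n)) //.
by apply: eq_big_nat => k /andP[_ kn]; rewrite /rterm yh.
Qed.

Lemma galerkin_lc r n h y g z : galerkin n h y -> galerkin n g z ->
  galerkin n (lc r h g) (lc r y z).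
Proof.
move=> [yn yh] [zn zg]; split; first exact: supp_lc.
by move=> k kn; rewrite action_lc /lc yh // zg.
Qed.

Hypothesis J_pos : op_positive J.

Lemma galerkin_ge0 n h y : galerkin n h y -> 0 <= rdot h y.
Proof.
move=> gy; rewrite -(galerkin_rdot gy gy.1).
exact/(jacobi_ge0 J_pos)/(jacobi_supp a b gy.1).
Qed.

(** * The inverse of the Friedrichs extension and the Galerkin defect *)

Variable K : (nat -> R[i]) -> nat -> R[i].
Hypothesis KT : forall h, ell2 h -> T (K h, h).

Lemma ell2_K h : ell2 h -> ell2 (K h).
Proof. by move=> /KT/(friedrichs_ell2 J_pos)[]. Qed.
Local Hint Resolve ell2_K ell2_lc : core.

Lemma K_sym h g : ell2 h -> ell2 g -> rdot h (K g) = rdot (K h) g.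
Proof. by move=> lh lg; exact: (friedrichs_sym J_pos (KT lh) (KT lg)). Qed.

(** Injectivity from symmetry: with [g = v - K h], both [<v, g>] and [<K h, g>] equal [<h, K g>], so
    [g] has norm 0. *)
Lemma friedrichs_K v h : T (v, h) -> v = K h.
Proof.
move=> Tvh; have [lv lh] := friedrichs_ell2 J_pos Tvh.
apply: sqd_eq0; [by []|by auto|].
have lg : ell2 (lc (-1) v (K h)) by auto.
have e := friedrichs_sym J_pos Tvh (KT lg).
by rewrite /sqd rdot_lcl; auto; rewrite -e K_sym //; ring.
Qed.

(** [K] is only a choice of preimages; its linearity follows from symmetry, by pairing the deviation
    with itself. *)
Lemma K_lc r h g : ell2 h -> ell2 g -> K (lc r h g) = lc r (K h) (K g).
Proof.
move=> lh lg; apply: sqd_eq0; [by auto|by auto|].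
set d := lc (-1) (K (lc r h g)) (lc r (K h) (K g)).
have ld : ell2 d by rewrite /d; auto 6.
rewrite /sqd -/d {1}/d !rdot_lcl; auto.
by rewrite -!K_sym ?rdot_lcl; auto; ring.
Qed.

Lemma K_0 : K (fun=> 0) = fun=> 0.
Proof. by rewrite -{1}(lcuu (fun=> 0)) K_lc ?lcuu //; exact: ell2_0. Qed.

Lemma galerkin_defect_sym n h y g z : ell2 h -> ell2 g ->
  galerkin n h y -> galerkin n g z ->
  rdot (lc (-1) (K h) y) g = rdot h (lc (-1) (K g) z).
Proof.
move=> lh lg gy gz; have ly := supp_ell2 gy.1; have lz := supp_ell2 gz.1.
rewrite rdot_lcl ?rdot_lcr; auto; rewrite K_sym //.
rewrite (rdotC y) -(galerkin_rdot gz gy.1) -(galerkin_rdot gy gz.1).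
by rewrite (rdotC (S z)) (jacobi_sym (jacobi_supp a b gy.1) (jacobi_supp a b gz.1)).
Qed.

(** The pairing is the form value of [K h - y]: the nonnegative form is expanded at [v_k - y], where
    [v_k] approximates [K h], and the limit in [k] is [<h, K h> - <h, y>]. *)
Lemma galerkin_defect_ge0 n h y : ell2 h -> galerkin n h y ->
  0 <= rdot (lc (-1) (K h) y) h.
Proof.
move=> lh gy; have ly := supp_ell2 gy.1; have lK := ell2_K lh.
have lSy := supp_ell2 (supp_action a b gy.1).
have Jy := jacobi_supp a b gy.1.
have TK := KT lh; have /(friedrichsP J_pos)[_ _ dv fv] := TK.
have [vn [vn' /form_seq_approx av]] := dv.
have c1 := fv _ _ _ _ _ dv av av; case: av => _ Jv cv _.
have lv k : ell2 (vn k) by have [] := jacobi_ell2 (Jv k).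
have c2 : rdot (vn k) (S y) @[k --> \oo] --> rdot (K h) (S y).
  by apply: rdot_cvg_l2 => //; exact: l2cvg_cst.
rewrite rdot_lcl // (rdotC (K h)) (rdotC y).
have eSy : rdot (K h) (S y) = rdot h y.
  exact: (friedrichs_supp J_pos TK gy.1).
have c : rdot (vn' k) (vn k) + (-1) * (2 * rdot (vn k) (S y)) + rdot h y
    @[k --> \oo] --> rdot h (K h) + -1 * rdot h y.
  rewrite -[X in _ --> X]
    (_ : rdot h (K h) + (-1) * (2 * rdot (K h) (S y)) + rdot h y = _).
    apply: cvgD; last exact: cvg_cst.
    apply: cvgD => //; apply: cvgM; first exact: cvg_cst.
    by apply: cvgM => //; exact: cvg_cst.
  by rewrite eSy; ring.
apply: (cvgr_to_ge c); apply: nearW => k.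
have := jacobi_ge0 J_pos (jacobi_lc (-1) (Jv k) Jy).
rewrite (jacobi_form_lc (-1) (Jv k) Jy) (jacobi_sym (Jv k) Jy).
by rewrite (galerkin_rdot gy gy.1) sqrrN expr1n mul1r.
Qed.

(** The Galerkin solution is optimal in the form: for a fixed finitely supported [u] near [K h],
    nonnegativity of the form at [u - y] bounds the defect by
    [(<S u, u> - <K h, h>) + 2 <K h - u, h>]. *)
Lemma galerkin_defect_cvg h (e : R) : ell2 h -> 0 < e ->
  exists N, forall n y, (N <= n)%N -> galerkin n h y ->
    rdot (lc (-1) (K h) y) h < e.
Proof.
move=> lh e0; have lK := ell2_K lh; have sh := sqn_ge0 lh.
pose d := e / 4; have d0 : 0 < d by rewrite /d; lra.
(* The second bound gives [<K h - u, h> < d] through Cauchy-Schwarz, and the [+ 1] avoids division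
   by 0. In all, the defect stays below [3 d < e]. *)
pose d' := Num.min d (d ^+ 2 / (sqn h + 1)).
have d'0 : 0 < d' by rewrite lt_min d0 divr_gt0 ?exprn_gt0 //; lra.
have [N [u [uN su tu]]] := friedrichs_approx J_pos (KT lh) d'0.
exists N => n y Nn gy; have {}uN := supp_le uN Nn.
have ly := supp_ell2 gy.1; have lu := supp_ell2 uN.
have Ju := jacobi_supp a b uN; have Jy := jacobi_supp a b gy.1.
have h1 : rdot (S u) u - rdot (K h) h < d.
  rewrite -(K_sym lh lh); apply: le_lt_trans (ler_norm _) _.
  by apply: lt_le_trans tu _; rewrite ge_min lexx.
have h2 : rdot (lc (-1) (K h) u) h < d.
  have cs := CauchySchwarz (ell2_lc (-1) lK lu) lh.
  rewrite -/(sqd (K h) u) sqdC // in cs.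
  have : sqd u (K h) < d ^+ 2 / (sqn h + 1).
    by apply: lt_le_trans su _; rewrite ge_min lexx orbT.
  rewrite ltr_pdivlMr ?ltr_wpDl // => lt.
  have := sqd_ge0 lu lK; move: cs lt => /=; nra.
rewrite rdot_lcl // (rdotC y); rewrite rdot_lcl // in h2.
have := jacobi_ge0 J_pos (jacobi_lc (-1) Ju Jy).
rewrite (jacobi_form_lc (-1) Ju Jy) (jacobi_sym Ju Jy) (rdotC u (S y)).
rewrite !(galerkin_rdot gy) //; last exact: gy.1.
rewrite (rdotC u h) in h2; have := e0; rewrite /d in h1 h2; lra.
Qed.

(** * Uniform bounds and compactness for the Galerkin solutions *)

Hypothesis galerkin_ex : forall n h, ell2 h -> exists y, galerkin n h y.

Hypothesis K_compact : forall hn, (forall n, ell2 (hn n)) ->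
  (exists M : R, forall n, sqn (hn n) <= M) ->
  exists (phi : nat -> nat) v, [/\ {homo phi : m n / (m < n)%N}, ell2 v &
    l2cvg ((K \o hn) \o phi) v].

(** Otherwise there are unit vectors whose images have squared norm at least [n], and these images
    have no convergent subsequence. *)
Lemma K_bounded : exists2 M : R, 0 <= M & forall h, ell2 h -> sqn (K h) <= M * sqn h.
Proof.
apply: contrapT => unb.
have ex n : exists h, ell2 h /\ n%:R * sqn h < sqn (K h).
  apply: contrapT => nex; apply: unb; exists n%:R => // h lh.
  by rewrite leNgt; apply/negP => lt; apply: nex; exists h.
have [hn hP] := choice ex.
have l0 : ell2 (fun=> 0 : R[i]) := ell2_0 R.
have pos n : 0 < sqn (hn n).
  have [lh lt] := hP n; rewrite lt_neqAle sqn_ge0 // andbT eq_sym; apply/negP => /eqP s0.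
  by move: lt; rewrite s0 mulr0 (sqn_eq0 lh s0) K_0 rdot0r ltxx.
pose c n := (Num.sqrt (sqn (hn n)))^-1.
have cP n : c n ^+ 2 * sqn (hn n) = 1.
  by rewrite exprVn sqr_sqrtr ?ltW // mulVf // gt_eqF.
pose gn n := lc (c n) (fun=> 0) (hn n).
have lg n : ell2 (gn n) by apply: ell2_lc0; have [] := hP n.
have big n : n%:R <= sqn (K (gn n)).
  have [lh lt] := hP n; have lK := ell2_K lh.
  have e : n%:R * (c n ^+ 2 * sqn (hn n)) = n%:R by rewrite cP mulr1.
  rewrite /gn K_lc // K_0 sqn_lc0 // -[leLHS]e mulrCA.
  by apply: ler_wpM2l; [exact: sqr_ge0|exact: ltW].
have [|phi [v [phi_incr lv cv]]] := K_compact lg.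
  by exists 1 => n; rewrite /gn sqn_lc0 ?cP //; have [] := hP n.
have lKg n : ell2 (K (gn (phi n))) := ell2_K (lg (phi n)).
have cs := rdot_cvg_l2 lKg lKg lv lv cv cv.
have [N _ hN] := (cvgrPdist_lt _ _).1 cs 1 ltr01.
(* At this index the image has squared norm below [sqn v + 1 < n], whereas [big] makes it at least
   [phi n >= n]. *)
pose n := maxn N (Num.bound (sqn v + 1)).
have := hN n (leq_maxl _ _); rewrite ltr_distl => /andP[+ _].
have := big (phi n); have phin := homo_ltn_ge phi_incr n.
have : sqn v + 1 < n%:R.
  apply: lt_le_trans (archi_boundP _) _; first by rewrite addr_ge0 ?sqn_ge0.
  by rewrite ler_nat leq_maxr.
have : n%:R <= (phi n)%:R :> R by rewrite ler_nat.
by move=> /=; lra.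
Qed.

(** With [D = K - K_n], a nonnegative symmetric operator below [K], Cauchy-Schwarz for the form of
    [D] at [h] and [d = D h] gives [|d|^4 <= <D h, h> <D d, d>]. As [<D d, d>] is at most a multiple
    of [|d|^2], one factor cancels. *)
Lemma galerkin_defect_bound : exists2 C : R, 0 <= C & forall n h y, ell2 h ->
  galerkin n h y -> sqn (lc (-1) (K h) y) <= C * rdot (lc (-1) (K h) y) h /\
  rdot (lc (-1) (K h) y) h <= rdot (K h) h.
Proof.
have [M M0 hM] := K_bounded; exists (M + 1); first by lra.
move=> n h y lh gy; have ly := supp_ell2 gy.1; have lK := ell2_K lh.
have le (g z : nat -> R[i]) : ell2 g -> galerkin n g z ->
    rdot (lc (-1) (K g) z) g <= rdot (K g) g.
  move=> lg gz; rewrite rdot_lcl //; [|by auto|exact: supp_ell2 gz.1].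
  by rewrite (rdotC z); have := galerkin_ge0 gz; lra.
split; last exact: le.
set d := lc (-1) (K h) y; have ld : ell2 d by rewrite /d; auto.
(* [z] is [K_n d], so that [K d - z] is [D d]. *)
have [z gz] := galerkin_ex n ld; have lz := supp_ell2 gz.1.
have dh0 := galerkin_defect_ge0 lh gy; rewrite -/d in dh0.
have CS : rdot d d ^+ 2 <= rdot d h * rdot (lc (-1) (K d) z) d.
  apply: discr_le; first exact: (galerkin_defect_ge0 ld gz).
  move=> t.
  have := galerkin_defect_ge0 (ell2_lc t lh ld) (galerkin_lc t gy gz).
  have lKd := ell2_K ld.
  rewrite K_lc // lc_lc -/d.
  have lD : ell2 (lc (-1) (K d) z) by auto.
  have lhd : ell2 (lc t h d) by auto.
  rewrite rdot_lcl // (rdot_lcr t lh ld ld) (rdot_lcr t lh ld lD).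
  rewrite (galerkin_defect_sym ld lh gz gy) -/d.
  by congr (0 <= _); ring.
(* From [|K d - d|^2 >= 0]. *)
have Kd : rdot (K d) d <= (M + 1) * sqn d.
  have := sqd_ge0 (ell2_K ld) ld; rewrite sqdE //; last by auto.
  have := hM _ ld; have := sqn_ge0 ld; have := mulr_ge0 M0 (sqn_ge0 ld); lra.
have {}CS : sqn d ^+ 2 <= rdot d h * ((M + 1) * sqn d).
  apply: le_trans CS _; apply: ler_wpM2l => //.
  exact: le_trans (le _ _ ld gz) Kd.
have := sqn_ge0 ld; rewrite le_eqVlt => /orP[/eqP <-|d0].
  by rewrite mulr_ge0 //; lra.
rewrite -(ler_pM2r d0) -expr2; apply: le_trans CS _.
by rewrite le_eqVlt; apply/orP; left; apply/eqP; ring.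
Qed.

(* Along a subsequence where [K h_i] converges, its Cauchy increments bound the
   defects [K h_i - y_i] uniformly in the dimension. *)
Lemma galerkin_compact hn yn (m : nat -> nat) (M : R) :
  (forall n, ell2 (hn n)) -> (forall n, sqn (hn n) <= M) ->
  (forall n, n <= m n)%N -> (forall n, galerkin (m n) (hn n) (yn n)) ->
  exists (phi : nat -> nat) v, [/\ {homo phi : m n / (m < n)%N}, ell2 v,
    l2cvg (yn \o phi) v & l2cvg ((K \o hn) \o phi) v].
Proof.
move=> lh hM mn gy.
have [|phi [v [phi_incr lv cv]]] := K_compact lh; first by exists M.
exists phi, v; split => //.
have phi_ge := homo_ltn_ge phi_incr.
have ly n : ell2 (yn n) := supp_ell2 (gy n).1.
have lKh n : ell2 (K (hn n)) := ell2_K (lh n).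
have M0 : 0 <= M := le_trans (sqn_ge0 (lh 0%N)) (hM 0%N).
have [C C0 hC] := galerkin_defect_bound.
pose d n := lc (-1) (K (hn (phi n))) (yn (phi n)).
have ld n : ell2 (d n) by rewrite /d; auto.
suff d0 : l2cvg d (fun=> 0).
  have l0 : ell2 (fun=> 0 : R[i]) := ell2_0 R.
  have := l2cvg_lc (-1) (fun n => lKh (phi n)) ld lv l0 cv d0.
  have -> : lc (-1) v (fun=> 0) = v.
    by apply/funext => k; rewrite /lc mulr0 addr0.
  congr (l2cvg _ v); apply/funext => n; apply/funext => k.
  by rewrite /d /lc rmorphN1 !mulN1r opprD opprK addNKr.
apply/cvgrPdist_lt => e e0.
(* The defects of the increment and of the fixed vector each get squared norm at most [C * f]; their
   sum then costs at most [4 * C * f < e]. *)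
pose f := e / (4 * (C + 1)); have f0 : 0 < f by rewrite divr_gt0 // mulr_gt0 //; lra.
(* For an increment [k], [|K k|^2 < 4 * f'] and [|k|^2 <= 4 * M], so Cauchy-Schwarz gives
   [<K k, k> <= f]. *)
pose f' := f ^+ 2 / (16 * M + 4).
have f'0 : 0 < f' by rewrite divr_gt0 ?exprn_gt0 //; lra.
have [N _ hN] := (cvgrPdist_lt _ _).1 cv _ f'0.
have [N2 hN2] := galerkin_defect_cvg (lh (phi N)) f0.
exists (maxn N N2) => // n /=; rewrite geq_max => /andP[Nn N2n].
rewrite sub0r normrN ger0_norm ?sqd_ge0 //; last exact: ell2_0.
have -> : sqd (d n) (fun=> 0) = sqn (d n).
  rewrite /sqd; suff -> : lc (-1) (d n) (fun=> 0) = d n by [].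
  by apply/funext => k; rewrite /lc mulr0 addr0.
have cK : sqd (K (hn (phi n))) (K (hn (phi N))) < 4 * f'.
  have := sqd_triangle (lKh (phi n)) lv (lKh (phi N)); rewrite (sqdC lv) //.
  have := hN n Nn; have := hN N (leqnn N).
  by rewrite /= !sub0r !normrN !ger0_norm ?sqd_ge0 //; lra.
have cH : sqd (hn (phi n)) (hn (phi N)) <= 4 * M.
  have := sqn_lc_le (-1) (lh (phi n)) (lh (phi N)); rewrite sqrrN expr1n mulr1.
  by rewrite /sqd; have := hM (phi n); have := hM (phi N); lra.
have Nmn : (N2 <= m (phi n))%N.
  exact: leq_trans N2n (leq_trans (phi_ge n) (mn _)).
have [z gz] := galerkin_ex (m (phi n)) (lh (phi N)).
have lz := supp_ell2 gz.1.
have h1 := hN2 _ _ Nmn gz.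
have [h2 _] := hC _ _ _ (lh (phi N)) gz.
have gyz := galerkin_lc (-1) (gy (phi n)) gz.
have ldh : ell2 (lc (-1) (hn (phi n)) (hn (phi N))) by auto.
have [h3 h4] := hC _ _ _ ldh gyz.
have lK2 := ell2_K ldh.
have h5 : rdot (K (lc (-1) (hn (phi n)) (hn (phi N))))
    (lc (-1) (hn (phi n)) (hn (phi N))) <= f.
  have := CauchySchwarz lK2 ldh; rewrite {2 3}K_lc //.
  rewrite -/(sqd (hn (phi n)) _) -/(sqd (K (hn (phi n))) _) => cs.
  have := sqd_ge0 (lKh (phi n)) (lKh (phi N)); have := sqd_ge0 (lh (phi n)) (lh (phi N)).
  move: cs cK cH; set p := rdot _ _; set q := sqd _ _; set s := sqd _ _.
  move=> cs cK cH s0 q0.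
  have fE : f' * (16 * M + 4) = f ^+ 2 by rewrite /f' divfK // gt_eqF //; lra.
  have qs : q * s <= 4 * f' * (4 * M) by apply: ler_pM => //; exact: ltW.
  rewrite leNgt; apply/negP => pf; have : f ^+ 2 < p ^+ 2 by nra.
  nra.
(* By linearity, the defect of [h_n] is that of the increment [h_n - h_N] plus that of the fixed
   vector [h_N], all in dimension [m (phi n)]. *)
have -> : d n = lc 1 (lc (-1) (K (lc (-1) (hn (phi n)) (hn (phi N))))
    (lc (-1) (yn (phi n)) z)) (lc (-1) (K (hn (phi N))) z).
  rewrite K_lc // lc_lc; apply/funext => k; rewrite /d /lc.
  by rewrite rmorph1 rmorphN1 !mulN1r !mul1r !subrK.
apply: le_lt_trans (sqn_lc_le 1 _ _) _; [by auto|by auto|].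
rewrite expr1n mulr1.
have h6 := ler_wpM2l C0 (le_trans h4 h5).
have h7 := ler_wpM2l C0 (ltW h1).
have fE : e = 4 * C * f + 4 * f by rewrite /f; field; lra.
by lra.
Qed.

Lemma K_cvg hn h : (forall n, ell2 (hn n)) -> ell2 h -> l2cvg hn h ->
  l2cvg (K \o hn) (K h).
Proof.
move=> lh l0 c; have [M M0 hM] := K_bounded.
apply: (@cvg0_le _ _ (fun n => M * sqd (hn n) h)).
  move=> n; have lK1 := ell2_K (lh n); have lK2 := ell2_K l0.
  have ld : ell2 (lc (-1) (hn n) h) by auto.
  by rewrite sqd_ge0 //= /sqd -K_lc //; exact: hM.
rewrite -[X in _ --> X](mulr0 M); apply: cvgM => //; exact: cvg_cst.
Qed.

End Galerkin.

(** * Interlacing of zeros *)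

Section Zeros.
Variables (R : realType) (a b : nat -> R).
Hypothesis a_gt0 : forall n, 0 < a n.
Local Notation P := (orthonormal_poly a b).

Lemma poly_rec n t : a n * (P n.+1).[t] =
  (t - b n) * (P n).[t] - (if n is k.+1 then a k * (P k).[t] else 0).
Proof.
rewrite [P n.+1]/= hornerZ mulrA mulfV ?gt_eqF // mul1r.
case: n => [|n]; first by rewrite subr0 hornerM !hornerE subr0.
by rewrite -[LHS]/((_ - _).[t]) hornerD hornerN hornerM hornerZ !hornerE.
Qed.

(** Two consecutive zeros would propagate down the recurrence to [P 0 = 1]. *)
Lemma poly_no_common_root n t : (P n).[t] = 0 -> (P n.+1).[t] <> 0.
Proof.
elim: n => [|n ih] p0 p1; first by move/eqP : p0; rewrite hornerE oner_eq0.
have := poly_rec n.+1 t; rewrite p1 p0 !mulr0 sub0r => /eqP.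
rewrite eq_sym oppr_eq0 mulf_eq0 gt_eqF //= => /eqP pn.
exact: ih pn p0.
Qed.

Lemma poly_size_lead n : size (P n) = n.+1 /\ 0 < lead_coef (P n).
Proof.
pose fact m := size (P m) = m.+1 /\ 0 < lead_coef (P m).
have step m : fact m -> (if m is k.+1 then fact k else True) -> fact m.+1.
  move=> [sm lm] sk; set q := if m is k.+1 then a k *: P k else 0.
  have Pm : P m.+1 = (a m)^-1 *: (('X - (b m)%:P) * P m - q) by [].
  have pm0 : P m != 0 by rewrite -size_poly_eq0 sm.
  have s1 : size (('X - (b m)%:P) * P m) = m.+2.
    by rewrite size_monicM ?monicXsubC // size_XsubC sm.
  have sq : (size (- q)%R < size (('X - (b m)%:P) * P m)%R)%N.
    rewrite s1 size_polyN /q; case: (m) sk => [|k] sk; first by rewrite size_poly0.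
    by rewrite size_scale ?gt_eqF //; case: sk => ->.
  rewrite /fact Pm size_scale ?invr_eq0 ?gt_eqF // size_polyDl // s1; split => //.
  rewrite lead_coefZ lead_coefDl // lead_coef_monicM ?monicXsubC //.
  by rewrite mulr_gt0 // invr_gt0.
have f0 : fact 0%N by rewrite /fact size_poly1 lead_coef1.
suff : fact n /\ fact n.+1 by case.
elim: n => [|n [fn fn1]]; first by split => //; exact: step.
by split => //; exact: step.
Qed.

(** * Counting zeros below a point *)

Definition count_lt (s : nat -> R) m z : nat := \sum_(0 <= i < m) (s i < z)%R.

Lemma count_ltS s m z : count_lt s m.+1 z = (count_lt s m z + (s m < z)%R)%N.
Proof. by rewrite /count_lt big_nat_recr. Qed.

(** The product has [m - count_lt s m z] negative factors, a number of the same parity as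
    [m + count_lt s m z]. *)
Lemma sign_prod_sub (s : nat -> R) z m : (forall i, (i < m)%N -> s i != z) ->
  0 < (-1) ^+ (m + count_lt s m z) * \prod_(0 <= i < m) (z - s i).
Proof.
elim: m => [|m ih] sz; first by rewrite /count_lt !big_nil addn0 expr0 mul1r.
rewrite count_ltS big_nat_recr //= -addn1 addnACA exprD mulrACA mulr_gt0 //.
  by apply: ih => i im; apply: sz; exact: leqW.
have := sz m (ltnSn m); case: (ltgtP (s m) z) => //= lt _.
- by rewrite -signr_odd expr0 mul1r subr_gt0.
- by rewrite -signr_odd expr1 mulN1r oppr_gt0 subr_lt0.
Qed.

Lemma initial_segment (s : nat -> R) z m :
  (forall i j, (i < j < m)%N -> s i < s j) ->
  (count_lt s m z <= m)%N /\
  forall i, (i < m)%N -> (s i < z) = (i < count_lt s m z)%N.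
Proof.
elim: m => [|m ih] incr; first by rewrite /count_lt big_nil.
have [|cm hc] := ih.
  by move=> i j /andP[ij jm]; apply: incr; rewrite ij leqW.
rewrite count_ltS; move: cm hc; set c := count_lt _ _ _ => cm hc.
have [lt|nlt] := ltP (s m) z.
  have cE : c = m.
    case: (m) incr cm hc lt => [|k] incr cm hc lt; first by lia.
    have := hc k (ltnSn k); rewrite (lt_trans _ lt) ?incr ?ltnSn //; lia.
  rewrite cE addn1; split => // i; rewrite ltnS leq_eqVlt => /orP[/eqP -> //|im].
    by rewrite lt; apply/esym; lia.
  by rewrite hc // cE; apply/idP/idP; lia.
rewrite addn0; split; first exact: leqW.
move=> i; rewrite ltnS leq_eqVlt => /orP[/eqP ->|im]; last exact: hc.
by rewrite ltNge nlt; apply/esym/negbTE; rewrite -leqNgt.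
Qed.

(** Parity forces [c] to start at 1 at least and to grow at every step, so [c j] is at least [j.+1].
    At [n] the value [n.+2] has the wrong parity, and descending from there the same growth gives
    the upper bound. *)
Lemma parity_count (c : nat -> nat) n :
  (forall j, (j < n)%N -> (c j <= c j.+1)%N) -> (c n <= n.+2)%N ->
  (forall j, (j <= n)%N -> odd (c j) = ~~ odd j) ->
  forall j, (j <= n)%N -> c j = j.+1.
Proof.
move=> c_incr c_le c_odd.
have lo j : (j <= n)%N -> (j < c j)%N.
  elim: j => [|j ih] jn; first by have := c_odd 0%N jn; case: (c 0%N).
  have := ih (ltnW jn); have := c_incr j jn; have := c_odd j.+1 jn.
  by rewrite /=; lia.
have hi k : (k <= n)%N -> (c (n - k) <= (n - k).+1)%N.
  elim: k => [|k ih] kn.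
    by rewrite subn0; have := c_odd n (leqnn n); move: c_le; lia.
  have := ih (ltnW kn); have e : (n - k = (n - k.+1).+1)%N by lia.
  rewrite e => h; have := c_incr (n - k.+1)%N; have := c_odd (n - k.+1)%N; lia.
move=> j jn; have := lo j jn; have := hi (n - j)%N (leq_subr _ _).
by rewrite subKn //; lia.
Qed.

Variable x : nat -> nat -> R.
Hypothesis x_incr : forall n i j, (i < j < n)%N -> x n i < x n j.
Hypothesis x_zero : forall n j, (j < n)%N -> root (P n) (x n j).

Lemma zeros_inj n i j : (i < n)%N -> (j < n)%N -> x n i = x n j -> i = j.
Proof.
move=> ni nj xij; case: (ltngtP i j) => // lt.
- by have := @x_incr n i j; rewrite lt nj xij ltxx => /(_ isT).
- by have := @x_incr n j i; rewrite lt ni xij ltxx => /(_ isT).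
Qed.

Lemma poly_factor n z :
  (P n).[z] = lead_coef (P n) * \prod_(0 <= i < n) (z - x n i).
Proof.
have [sn _] := poly_size_lead n.
pose rs := [seq x n i | i <- index_iota 0 n].
have srs : size rs = n by rewrite size_map size_iota subn0.
rewrite {1}(@all_roots_prod_XsubC _ (P n) rs).
- rewrite hornerZ; congr (_ * _); rewrite big_map horner_prod.
  by apply: eq_bigr => i _; rewrite hornerXsubC.
- by rewrite sn srs.
- by apply/allP => _ /mapP[i + ->]; rewrite mem_index_iota => /andP[_ /x_zero].
- rewrite uniq_rootsE map_inj_in_uniq ?iota_uniq // => i j.
  by rewrite !mem_index_iota => /andP[_ ni] /andP[_ nj]; exact: zeros_inj.
Qed.

Local Notation cnt n z := (count_lt (x n) n z).

Lemma poly_sign n z : (P n).[z] != 0 -> 0 < (-1) ^+ (n + cnt n z) * (P n).[z].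
Proof.
move=> pz; rewrite poly_factor mulrCA mulr_gt0 //; first by have [] := poly_size_lead n.
apply: sign_prod_sub => i ni; apply: contra_neq pz => <-.
by apply/eqP; exact: x_zero.
Qed.

(** At a zero of [P n.+1] the recurrence makes [P n] and [P n.+2] nonzero of opposite signs, and
    each sign is read off the parity of the number of zeros below [z]. *)
Lemma count_parity n z : (P n.+1).[z] = 0 ->
  odd (cnt n.+2 z) = ~~ odd (cnt n z).
Proof.
move=> p1; have p0 : (P n).[z] != 0.
  by apply/eqP => p0; exact: poly_no_common_root p0 p1.
have := poly_rec n.+1 z; rewrite p1 mulr0 sub0r => rec.
have p2 : (P n.+2).[z] != 0.
  apply/eqP => p2; move: rec; rewrite p2 mulr0 => /eqP.
  by rewrite eq_sym oppr_eq0 mulf_eq0 gt_eqF // (negbTE p0).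
have s0 := poly_sign p0; have s2 := poly_sign p2.
have {}s0 := mulr_gt0 (a_gt0 n) s0; have {}s2 := mulr_gt0 (a_gt0 n.+1) s2.
move: s0 s2; rewrite !(mulrCA (a _)) rec -!(signr_odd _ (_ + _)) !oddD /= negbK.
case: (odd n); case: (odd (cnt n z)); case: (odd (cnt n.+2 z)) => //=;
  rewrite ?expr0 ?expr1; lra.
Qed.

(** Induction on [n]: the first claim gives the second through [count_parity] and [parity_count];
    the second, read as an order relation between zeros of consecutive polynomials, gives the first
    at [n.+1]. *)
Lemma interlacing n : (forall j, (j <= n)%N -> cnt n (x n.+1 j) = j) /\
  forall j, (j <= n)%N -> cnt n.+2 (x n.+1 j) = j.+1.
Proof.
have second m : (forall j, (j <= m)%N -> cnt m (x m.+1 j) = j) ->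
    forall j, (j <= m)%N -> cnt m.+2 (x m.+1 j) = j.+1.
  move=> h; apply: (@parity_count (fun j => cnt m.+2 (x m.+1 j))).
  - move=> j jm; apply: leq_sum => i _.
    have [lt|//] := ltP (x m.+2 i) (x m.+1 j).
    by rewrite (lt_trans lt) // x_incr // ltnSn.
  - by have [] := initial_segment (x m.+1 m) (@x_incr m.+2).
  - move=> j jm; rewrite count_parity ?h //.
    by apply/eqP; exact: x_zero.
suff h j : (j <= n)%N -> cnt n (x n.+1 j) = j by split => //; exact: second.
elim: n j => [|n ih] j; first by rewrite leqn0 => /eqP ->; rewrite /count_lt big_nil.
move=> jn.
(* Inversion of the count: exactly the zeros of index at most [i] lie below [x n.+1 i], and a common
   zero is excluded. *)
have e i : (0 <= i < n.+1)%N -> (x n.+1 i < x n.+2 j)%R = (i < j)%N :> nat.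
  move=> /andP[_ ni]; have [_ /(_ j jn)] := initial_segment (x n.+1 i) (@x_incr n.+2).
  rewrite second // ltnS => lt; congr nat_of_bool.
  rewrite [RHS]ltnNge -lt -leNgt lt_neqAle; case: eqP => //= e.
  have r1 := x_zero ni; have r2 := x_zero (jn : (j < n.+2)%N); rewrite -e in r2.
  by case: (poly_no_common_root (eqP r1) (eqP r2)).
rewrite /count_lt (eq_big_nat _ _ e) (big_cat_nat (n := j)) //=.
rewrite (eq_big_nat _ _ (F2 := fun=> 1%N)); last by move=> i /andP[_ ->].
rewrite sum_nat_const_nat subn0 muln1 big_nat_cond big1 ?addn0 //.
by move=> i /andP[/andP[ji _] _]; rewrite ltnNge ji.
Qed.

(** Only [j] zeros of [P n] lie below [x n.+1 j], so the one of index [j] does not; equality would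
    be a common zero. *)
Lemma zeros_decreasing n j : (j < n)%N -> x n.+1 j < x n j.
Proof.
move=> jn; have [h _] := interlacing n.
have [_ /(_ j jn)] := initial_segment (x n.+1 j) (@x_incr n).
rewrite h ?ltnn; last exact: ltnW.
move=> /negbT; rewrite -leNgt le_eqVlt => /orP[/eqP e|//].
have /eqP r1 := x_zero jn; have /eqP := x_zero (leqW jn : (j < n.+1)%N).
by rewrite e => r2; case: (poly_no_common_root r1 r2).
Qed.

End Zeros.

(** * Eigenvectors of the truncations *)

(** A one-sided inverse of a square matrix is two-sided, so orthonormal rows make orthonormal
    columns. *)
Lemma orthonormal_transpose (R : comUnitRingType) (e : nat -> nat -> R) n :
  (forall i j, (i < n)%N -> (j < n)%N -> \sum_(k < n) e i k * e j k = (i == j)%:R) ->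
  forall k l, (k < n)%N -> (l < n)%N -> \sum_(j < n) e j k * e j l = (k == l)%:R.
Proof.
move=> orth k l kn ln.
pose U : 'M[R]_n := \matrix_(i, j) e i j.
have UUT : U *m U^T = 1%:M.
  apply/matrixP => i j; rewrite !mxE -(orth i j) //.
  by apply: eq_bigr => m _; rewrite !mxE.
have /matrixP/(_ (Ordinal kn) (Ordinal ln)) := mulmx1C UUT.
by rewrite !mxE => <-; apply: eq_bigr => m _; rewrite !mxE.
Qed.

Lemma orthonormal_parseval (R : comUnitRingType) (e : nat -> nat -> R) (c : nat -> R) n :
  (forall i j, (i < n)%N -> (j < n)%N -> \sum_(k < n) e i k * e j k = (i == j)%:R) ->
  \sum_(k < n) (\sum_(j < n) e j k * c j) ^+ 2 = \sum_(j < n) c j ^+ 2.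
Proof.
move=> orth.
have -> : \sum_(k < n) (\sum_(j < n) e j k * c j) ^+ 2 =
    \sum_(i < n) \sum_(j < n) \sum_(k < n) (e i k * e j k) * (c i * c j).
  under [RHS]eq_bigr do rewrite exchange_big /=.
  rewrite [RHS]exchange_big /=; apply: eq_bigr => k _.
  rewrite expr2 big_distrlr /=.
  by apply: eq_bigr => i _; apply: eq_bigr => j _; rewrite mulrACA.
apply: eq_bigr => i _; rewrite (bigD1 i) //= -mulr_suml orth // eqxx mul1r.
rewrite big1 ?addr0 ?expr2 // => j ji; rewrite -mulr_suml orth //.
by rewrite eq_sym (inj_eq val_inj) (negbTE ji) mul0r.
Qed.

Section Eigenvectors.
Variables (R : realType) (a b : nat -> R).
Hypothesis a_gt0 : forall n, 0 < a n.
Local Notation P := (orthonormal_poly a b).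
Local Notation S := (jacobi_action a b).

(** At two zeros of [P n.+1] the right side vanishes, which yields the orthogonality of the
    eigenvectors. *)
Lemma christoffel_darboux n s t :
  (s - t) * \sum_(k < n.+1) (P k).[s] * (P k).[t] =
  a n * ((P n.+1).[s] * (P n).[t] - (P n).[s] * (P n.+1).[t]).
Proof.
have e m (A B C D : R) : a m * (A * B - C * D) = (a m * A) * B - C * (a m * D) by ring.
elim: n => [|n ih].
  have p0 u : (P 0).[u] = 1 by rewrite hornerE.
  by rewrite big_ord1 e !(poly_rec b a_gt0) !p0; ring.
by rewrite big_ord_recr /= mulrDr ih [RHS]e !(poly_rec b a_gt0 n.+1); ring.
Qed.

Variable x : nat -> nat -> R.
Hypothesis x_incr : forall n i j, (i < j < n)%N -> x n i < x n j.
Hypothesis x_zero : forall n j, (j < n)%N -> root (P n) (x n j).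

Definition evec_norm n j : R := Num.sqrt (\sum_(k < n) (P k).[x n j] ^+ 2).

(** Normalized eigenvector of the truncation [J_n] for the eigenvalue [x n j]; the formula continues
    past the index [n]. *)
Definition evec n j k : R := (P k).[x n j] / evec_norm n j.

Lemma evec_norm_gt0 n j : (j < n)%N -> 0 < evec_norm n j.
Proof.
case: n => // n _; rewrite sqrtr_gt0 big_ord_recl /= hornerE expr1n.
by rewrite ltr_pwDl // sumr_ge0 // => i _; exact: sqr_ge0.
Qed.

Lemma evec_orth n i j : (i < n)%N -> (j < n)%N ->
  \sum_(k < n) evec n i k * evec n j k = (i == j)%:R.
Proof.
move=> ni nj; have Ni := evec_norm_gt0 ni; have Nj := evec_norm_gt0 nj.
have -> : \sum_(k < n) evec n i k * evec n j k =
    (\sum_(k < n) (P k).[x n i] * (P k).[x n j]) / (evec_norm n i * evec_norm n j).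
  rewrite mulr_suml; apply: eq_bigr => k _; rewrite /evec; field.
  by rewrite !gt_eqF.
have [<-|/eqP ij] := eqVneq i j.
  rewrite -expr2 sqr_sqrtr; last by apply: sumr_ge0 => k _; exact: sqr_ge0.
  under eq_bigr do rewrite -expr2.
  by rewrite divff // gt_eqF // -sqrtr_gt0.
suff -> : \sum_(k < n) (P k).[x n i] * (P k).[x n j] = 0 by rewrite mul0r.
have := x_zero ni; have := x_zero nj.
case: n {Ni Nj} ni nj => // n ni nj /eqP rj /eqP ri.
have /eqP := christoffel_darboux n (x n.+1 i) (x n.+1 j).
rewrite ri rj mul0r mulr0 subr0 mulr0 mulf_eq0 subr_eq0.
by move=> /orP[/eqP/(zeros_inj x_incr ni nj)//|/eqP].
Qed.

(** The entry just past the truncation vanishes, so [evec_rec] at [k = n - 1] is the last row of the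
    truncated eigenvalue equation. *)
Lemma evec_last n j : (j < n)%N -> evec n j n = 0.
Proof. by move=> /x_zero/eqP; rewrite /evec => ->; rewrite mul0r. Qed.

Lemma evec_rec n j k : (if k is m.+1 then a m * evec n j m else 0) +
  b k * evec n j k + a k * evec n j k.+1 = x n j * evec n j k.
Proof.
rewrite /evec [a k * _]mulrA (poly_rec b a_gt0); case: k => [|k]; ring.
Qed.

(** Spectral expansion: [y] is the sum of [<e_j, g> / (x n j - z)] times [e_j], bounded by Parseval
    and the gap [d]. *)
Lemma real_shifted_solve n z (d : R) (g : nat -> R) : 0 < d ->
  (forall j, (j < n)%N -> d <= `|x n j - z|) ->
  exists y : nat -> R, [/\ forall k, (n <= k)%N -> y k = 0,
    forall k, (k < n)%N -> (if k is m.+1 then a m * y m else 0) +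
      b k * y k + a k * y k.+1 = z * y k + g k &
    d ^+ 2 * (\sum_(k < n) y k ^+ 2) <= \sum_(k < n) g k ^+ 2].
Proof.
move=> d0 xz; pose e := evec n.
have xz0 j : (j < n)%N -> x n j - z != 0.
  by move=> /xz; rewrite -normr_gt0; exact: lt_le_trans.
pose f j := \sum_(l < n) e j l * g l.
pose c j := f j / (x n j - z).
pose Y k := \sum_(j < n) e j k * c j.
(* The cutoff still agrees with [Y] at [k = n], where the eigenvectors vanish; the last row of the
   equation uses that entry. *)
pose y k := if (k < n)%N then Y k else 0.
have yY k : (k <= n)%N -> y k = Y k.
  rewrite leq_eqVlt /y => /orP[/eqP ->|->//]; rewrite ltnn /Y big1 // => j _.
  by rewrite /e evec_last // mul0r.
have orth := @evec_orth n.
have comp := orthonormal_transpose orth.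
exists y; split.
- by move=> k nk; rewrite /y ltnNge nk.
- move=> k kn.
  have -> : (if k is m.+1 then a m * y m else 0) + b k * y k + a k * y k.+1 =
      (if k is m.+1 then a m * Y m else 0) + b k * Y k + a k * Y k.+1.
    by case: k kn => [|k] kn; rewrite !yY //; exact: leqW (ltnW kn) || exact: ltnW.
  have -> : (if k is m.+1 then a m * Y m else 0) + b k * Y k + a k * Y k.+1 =
      \sum_(j < n) x n j * e j k * c j.
    case: k {kn} => [|k]; rewrite ?add0r /Y !mulr_sumr -!big_split /=;
      apply: eq_bigr => j _; rewrite -evec_rec -/e; ring.
  rewrite yY ?(ltnW kn) // /Y mulr_sumr.
  (* Completeness of the eigenvectors, through the transposed orthonormality. *)
  have -> : g k = \sum_(j < n) e j k * f j.
    under eq_bigr do rewrite /f mulr_sumr.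
    rewrite exchange_big /= (bigD1 (Ordinal kn)) //=.
    under eq_bigr do rewrite mulrA.
    rewrite -mulr_suml comp // eqxx mul1r big1 ?addr0 // => l lk.
    under eq_bigr do rewrite mulrA.
    rewrite -mulr_suml comp // (_ : (k == l) = false) ?mul0r //.
    by apply/negbTE; rewrite eq_sym -(inj_eq val_inj) in lk *.
  rewrite -big_split /=; apply: eq_bigr => j _; rewrite /c; field.
  exact: xz0.
- under eq_bigr => k _ do rewrite yY ?(ltnW (ltn_ord k)) // /Y.
  rewrite (orthonormal_parseval c orth) mulr_sumr.
  rewrite -(@orthonormal_parseval _ (fun l j => e j l) g n) //.
  apply: ler_sum => j _; rewrite -/(f j) /c expr_div_n mulrA.
  rewrite ler_pdivrMr ?exprn_even_gt0 ?xz0 // [leRHS]mulrC ler_wpM2r ?sqr_ge0 //.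
  rewrite -[leRHS]real_normK ?num_real // ler_pXn2r ?nnegrE ?normr_ge0 ?(ltW d0) //.
  exact: xz.
Qed.

(** The equation [(J_n - z) y = P_n g], made a Galerkin equation by moving [z y] to the right. The
    matrix and [z] are real, so real and imaginary parts are solved separately. *)
Lemma galerkin_shifted n z (d : R) (g : nat -> R[i]) : 0 < d -> ell2 g ->
  (forall j, (j < n)%N -> d <= `|x n j - z|) ->
  exists2 y, galerkin a b n (lc z g y) y & d ^+ 2 * sqn y <= sqn g.
Proof.
move=> d0 lg xz.
have [yr [yr0 yrE yrn]] := real_shifted_solve (fun k => complex.Re (g k)) d0 xz.
have [yi [yi0 yiE yin]] := real_shifted_solve (fun k => complex.Im (g k)) d0 xz.
exists (fun k => yr k +i* yi k).
  split; first by move=> k nk; rewrite yr0 ?yi0.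
  move=> k kn; apply: complex_ext.
    by rewrite Re_action Re_lc /= addrC [RHS]addrC -yrE // addrC; case: (k).
  by rewrite Im_action Im_lc /= addrC [RHS]addrC -yiE // addrC; case: (k).
rewrite (rdot_supp (n := n)); last by move=> k nk; rewrite yr0 ?yi0.
apply: (@le_trans _ _ (\sum_(k < n) rterm g g k)).
  rewrite big_mkord /rterm /= !big_split /= mulrDr.
  under eq_bigr do rewrite -expr2. under [X in _ + d ^+ 2 * X]eq_bigr do rewrite -expr2.
  under [X in _ <= X + _]eq_bigr do rewrite -expr2.
  under [X in _ <= _ + X]eq_bigr do rewrite -expr2.
  exact: lerD.
rewrite -(big_mkord xpredT (rterm g g)).
apply: nondecreasing_cvgn_le; last by exact/ell2P.
by apply: nondecreasing_series => m _ _; exact: rterm_ge0.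
Qed.

Lemma galerkin_evec n j (y := fun k => if (k < n)%N then (evec n j k)%:C else 0) :
  (j < n)%N -> galerkin a b n (lc (x n j) (fun=> 0) y) y.
Proof.
move=> jn; split=> [k nk|k kn]; first by rewrite /y ltnNge nk.
have yE m : (m <= n)%N -> y m = (evec n j m)%:C.
  by rewrite leq_eqVlt /y => /orP[/eqP ->|->//]; rewrite ltnn evec_last.
apply: complex_ext.
  rewrite Re_action Re_lc /= add0r !yE ?(ltnW kn) //= -evec_rec.
  by case: k kn => [//|k] kn; rewrite yE //; exact: ltnW (ltnW kn).
rewrite Im_action Im_lc /= add0r !yE ?(ltnW kn) //= !mulr0 !addr0.
by case: k kn => [//|k] kn; rewrite yE ?mulr0 //; exact: ltnW (ltnW kn).
Qed.

End Eigenvectors.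

(** * Limits of zeros and the spectrum *)

Section Spectrum.
Variables (R : realType) (a b : nat -> R).
Hypothesis a_gt0 : forall n, 0 < a n.
Local Notation P := (orthonormal_poly a b).
Local Notation S := (jacobi_action a b).
Local Notation J := (jacobi a b).
Local Notation T := (friedrichs J).
Hypothesis J_pos : op_positive J.
Hypothesis JF_inv_compact : compact_op (op_inverse T).
Variable x : nat -> nat -> R.
Hypothesis x_incr : forall n i j, (i < j < n)%N -> x n i < x n j.
Hypothesis x_zero : forall n j, (j < n)%N -> root (P n) (x n j).

Definition tvec n j : nat -> R[i] :=
  fun k => if (k < n)%N then (evec a b x n j k)%:C else 0.

Lemma tvec_supp n j : supp n (tvec n j).
Proof. by move=> k nk; rewrite /tvec ltnNge nk. Qed.

Lemma tvec_ell2 n j : ell2 (tvec n j).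
Proof. exact: supp_ell2 (@tvec_supp n j). Qed.
Local Hint Resolve tvec_ell2 : core.

Lemma tvec_orth n i j : (i < n)%N -> (j < n)%N ->
  rdot (tvec n i) (tvec n j) = (i == j)%:R.
Proof.
move=> ni nj; rewrite (rdot_supp (n := n)); last exact: tvec_supp.
rewrite big_mkord -(evec_orth a_gt0 x_incr x_zero ni nj); apply: eq_bigr => k _.
by rewrite /rterm /tvec ltn_ord /= mulr0 addr0.
Qed.

Lemma zeros_ge0 n j : (j < n)%N -> 0 <= x n j.
Proof.
move=> nj; have := galerkin_ge0 J_pos (galerkin_evec a_gt0 x_zero nj).
by rewrite -/(tvec n j) rdot_lc0 // tvec_orth // eqxx mulr1.
Qed.

(** Strict because the zero decreases strictly to the next one, which is still nonnegative. *)
Lemma zeros_gt0 n j : (j < n)%N -> 0 < x n j.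
Proof.
move=> nj; apply: le_lt_trans (zeros_decreasing a_gt0 x_incr x_zero nj).
exact: zeros_ge0 (leqW nj).
Qed.

Lemma galerkin_exists n h : ell2 h -> exists y, galerkin a b n h y.
Proof.
(* The smallest zero is the distance from [z = 0] to the zeros of [P n]; the value at [n = 0] is
   arbitrary. *)
move=> lh; pose d := if n is 0 then 1 else x n 0.
have d0 : 0 < d by rewrite /d; case: (n) => // k; exact: zeros_gt0.
have [|y gy _] := galerkin_shifted a_gt0 x_incr x_zero (n := n) (z := 0) d0 lh.
  move=> j jn; rewrite subr0 ger0_norm ?zeros_ge0 // /d.
  case: (n) jn => // k; case: j => // j jn; apply: ltW; exact: x_incr.
by exists y; rewrite lc0 in gy.
Qed.

Lemma inverse_exists : exists K : (nat -> R[i]) -> nat -> R[i],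
  (forall h, ell2 h -> T (K h, h)) /\
  forall hn : nat -> nat -> R[i], (forall n, ell2 (hn n)) ->
    (exists M : R, forall n, sqn (hn n) <= M) ->
    exists (phi : nat -> nat) v, [/\ {homo phi : m n / (m < n)%N}, ell2 v &
      l2cvg ((K \o hn) \o phi) v].
Proof.
have [ed cpt] := JF_inv_compact.
have /choice[K KT] : forall h, exists v, ell2 h -> T (v, h).
  move=> h; have [lh|nlh] := pselect (ell2 h); last by exists h.
  by have [v [Tv _]] := ed h lh; exists v.
exists K; split => // hn lh [M hM].
have [||phi [v [phi_incr lv cv]]] := cpt hn (K \o hn).
- by exists M => n; rewrite normsqE // lee_fin.
- by move=> n; exact: KT.
exists phi, v; split => //; apply/ell2_cvgE => // n.
by have [] := friedrichs_ell2 J_pos (KT _ (lh (phi n))).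
Qed.

Lemma op_shift_real z y g : op_shift T z%:C (y, g) <-> T (y, lc z g y).
Proof.
split=> [[v Tv gE]|Tv].
  move: gE => /= gE; subst g.
  have e : lc z (v \- (fun k => z%:C * y k)) y = v.
    by apply/funext => k; rewrite /lc /= subrK.
  by rewrite e.
exists (lc z g y) => //; apply/funext => k.
by rewrite /lc /= addrK.
Qed.

(** The shift by [j.+1] keeps to degrees where the zero of index [j] exists; nothing is assumed
    about [x n j] for [j >= n]. *)
Definition zlim j : R := limn (fun n => x (n + j.+1) j).

Lemma zeros_cvg_shift j : x (n + j.+1) j @[n --> \oo] --> zlim j.
Proof.
have jn n : (j < n + j.+1)%N by lia.
apply: nonincreasing_is_cvgn; last by exists 0 => _ [n _ <-]; exact: zeros_ge0.
apply/nonincreasing_seqP => n; apply: ltW.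
exact: (zeros_decreasing a_gt0 x_incr x_zero (jn n)).
Qed.

Lemma zeros_cvg j : x n j @[n --> \oo] --> zlim j.
Proof.
by have := @zeros_cvg_shift j; rewrite -(cvg_shiftn j.+1 (fun n => x n j)).
Qed.

Lemma zlim_le n j : (j < n)%N -> zlim j <= x n j.
Proof.
move=> jn; have := @zeros_cvg_shift j => c.
apply: (cvgr_to_le c); exists (n - j.+1)%N => // m /= nm.
have : (n <= m + j.+1)%N by lia.
elim: (m + j.+1)%N => [|p ih]; first by move: jn; rewrite leqn0 => + /eqP n0; rewrite n0.
rewrite leq_eqVlt => /orP[/eqP -> //|np].
apply: le_trans (ih np); apply: ltW.
by apply: (zeros_decreasing a_gt0 x_incr x_zero); exact: leq_trans jn np.
Qed.

(** * Limits of eigenvectors, and the resolvent set *)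

Section WithInverse.
Variable K : (nat -> R[i]) -> nat -> R[i].
Hypothesis KT : forall h, ell2 h -> T (K h, h).
Hypothesis K_compact : forall hn : nat -> nat -> R[i], (forall n, ell2 (hn n)) ->
    (exists M : R, forall n, sqn (hn n) <= M) ->
    exists (phi : nat -> nat) v, [/\ {homo phi : m n / (m < n)%N}, ell2 v &
      l2cvg ((K \o hn) \o phi) v].

(** The eigenvectors [y_n] solve Galerkin equations with data [x y_n], bounded since the zeros
    decrease. Compactness gives a common limit [u] of [y_n] and [K (x y_n)], and continuity of [K]
    then gives [u = K (zlim j u)]. The degrees [m] are left free so that two such limits can be
    taken along nested subsequences. *)
Lemma eigenvector_limit j (m : nat -> nat) : (forall n, n <= m n)%N ->
  (forall n, j < m n)%N ->
  exists (phi : nat -> nat) u, [/\ {homo phi : m n / (m < n)%N}, ell2 u,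
    l2cvg (fun n => tvec (m (phi n)) j) u, sqn u = 1 &
    T (u, lc (zlim j) (fun=> 0) u)].
Proof.
move=> mn jm; pose hn n := lc (x (m n) j) (fun=> 0) (tvec (m n) j).
have lh n : ell2 (hn n) by exact: ell2_lc0.
have sh n : sqn (hn n) = x (m n) j ^+ 2.
  by rewrite sqn_lc0 // tvec_orth // eqxx mulr1.
have lam0 : 0 <= zlim j.
  apply: (cvgr_to_ge (@zeros_cvg_shift j)); apply: nearW => n.
  by apply: zeros_ge0; lia.
have bnd n : sqn (hn n) <= x j.+1 j ^+ 2.
  rewrite sh; apply: lerXn2r; rewrite ?nnegrE ?zeros_ge0 //.
  have := jm n; elim: (m n) => // p ih; rewrite ltnS leq_eqVlt => /orP[/eqP -> //|jp].
  exact: le_trans (ltW (zeros_decreasing a_gt0 x_incr x_zero jp)) (ih jp).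
have gal n : galerkin a b (m n) (hn n) (tvec (m n) j) by exact: galerkin_evec.
have [phi [v [phi_incr lv cy cK]]] :=
  galerkin_compact J_pos KT galerkin_exists K_compact lh bnd mn gal.
have phi_ge := homo_ltn_ge phi_incr.
exists phi, v.
have xl : x (m (phi n)) j @[n --> \oo] --> zlim j.
  apply: cvg_comp (@zeros_cvg j); apply: cvg_ge_id => n.
  exact: leq_trans (phi_ge n) (mn _).
have sv : sqn v = 1.
  apply: cvg_unique (rdot_cvg_l2 (fun n => tvec_ell2 _ j)
    (fun n => tvec_ell2 _ j) lv lv cy cy) _ => //=.
  under eq_fun do rewrite tvec_orth // eqxx; exact: cvg_cst.
split => //.
have lK : ell2 (lc (zlim j) (fun=> 0) v) by exact: ell2_lc0.
have hl : l2cvg (hn \o phi) (lc (zlim j) (fun=> 0) v).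
  apply: (@cvg0_le _ _ (fun n => 2 * (x (m (phi n)) j - zlim j) ^+ 2 +
      2 * (zlim j) ^+ 2 * sqd (tvec (m (phi n)) j) v)).
    move=> n; rewrite sqd_ge0 //=; set y := tvec _ _; set r := x _ _.
    have ly : ell2 y by exact: tvec_ell2.
    rewrite /hn -/y -/r.
    have ld : ell2 (lc (-1) y v) by exact: ell2_lc.
    (* With [l = zlim j]: [r y - l v = (r - l) y + l (y - v)]. *)
    have e : lc (-1) (lc r (fun=> 0) y) (lc (zlim j) (fun=> 0) v) =
        lc (zlim j) (lc (r - zlim j) (fun=> 0) y) (lc (-1) y v).
      apply/funext => k; apply: complex_ext.
        by rewrite !Re_lc /=; ring.
      by rewrite !Im_lc /=; ring.
    rewrite /sqd e.
    apply: le_trans (sqn_lc_le _ (ell2_lc0 _ ly) ld) _.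
    by rewrite sqn_lc0 // /y tvec_orth // eqxx mulr1.
  rewrite -[X in _ --> X](_ : 2 * (zlim j - zlim j) ^+ 2 + 2 * (zlim j) ^+ 2 * 0 = 0);
    last by rewrite subrr expr0n !mulr0 addr0.
  apply: cvgD; apply: cvgM => //; try exact: cvg_cst.
  by apply: cvgM; apply: cvgB => //; exact: cvg_cst.
have vK : v = K (lc (zlim j) (fun=> 0) v).
  have lKl : ell2 (K (lc (zlim j) (fun=> 0) v)) by exact: (ell2_K J_pos KT).
  apply: (l2cvg_uniq (un := (K \o hn) \o phi)) => //.
    by move=> n; exact: (ell2_K J_pos KT).
  apply: (K_cvg J_pos KT K_compact (hn := hn \o phi)) => // n.
  exact: lh.
by rewrite {1}vK; exact: KT.
Qed.

(** Each eigenvector is its first entry times the values of the [P k], and this passes to the limit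
    by continuity: the eigenvalue and the first entry determine the limit. *)
Lemma eigenvector_limit_coord j (m : nat -> nat) u : (forall n, n <= m n)%N ->
  ell2 u -> l2cvg (fun n => tvec (m n) j) u ->
  forall k, complex.Re (u k) = complex.Re (u 0%N) * (P k).[zlim j] /\
    complex.Im (u k) = 0.
Proof.
move=> mn lu cu k; have [cRe cIm] := l2cvg_coord k (fun n => tvec_ell2 _ j) lu cu.
have [cRe0 _] := l2cvg_coord 0 (fun n => tvec_ell2 _ j) lu cu.
have xl : x (m n) j @[n --> \oo] --> zlim j.
  by apply: cvg_comp (@zeros_cvg j); exact: cvg_ge_id.
have Pl : (P k).[x (m n) j] @[n --> \oo] --> (P k).[zlim j].
  exact: (continuous_cvg _ (@continuous_horner _ (P k) (zlim j)) xl).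
split; last first.
  apply: cvg_unique cIm _ => //.
  suff -> : (fun n => complex.Im (tvec (m n) j k)) = fun=> 0.
    exact: cvg_cst.
  by apply/funext => n; rewrite /tvec; case: ifP.
apply: cvg_unique cRe _ => //; apply: cvg_trans (cvgM cRe0 Pl).
apply: near_eq_cvg; exists k.+1 => // n /= kn.
have km : (k < m n)%N by exact: leq_trans kn (mn n).
rewrite /tvec km (leq_trans _ km) //= /evec hornerE mul1r.
by rewrite mulrC.
Qed.

Lemma zlim_neq i j : i != j -> zlim i <> zlim j.
Proof.
move=> ij lij; pose m0 n := (n + (i + j).+1)%N.
have m0n n : (n <= m0 n)%N by rewrite leq_addr.
have im n : (i < m0 n)%N by rewrite /m0; lia.
have jm n : (j < m0 n)%N by rewrite /m0; lia.
have [phi [u [phi_incr lu cu su _]]] := eigenvector_limit m0n im.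
have phin := homo_ltn_ge phi_incr.
have m1n n : (n <= m0 (phi n))%N by exact: leq_trans (phin n) (m0n _).
have [psi [v [psi_incr lv cv sv _]]] := eigenvector_limit m1n (fun n => jm (phi n)).
have psin := homo_ltn_ge psi_incr.
have m2n n : (n <= m0 (phi (psi n)))%N by exact: leq_trans (psin n) (m1n _).
have {}cu : l2cvg (fun n => tvec (m0 (phi (psi n))) i) u by exact: (l2cvg_sub psin cu).
have uv0 : rdot u v = 0.
  apply: cvg_unique (rdot_cvg_l2 (fun n => tvec_ell2 _ i) (fun n => tvec_ell2 _ j)
    lu lv cu cv) _ => //=.
  under eq_fun do rewrite tvec_orth // (negbTE ij); exact: cvg_cst.
have uE := eigenvector_limit_coord m2n lu cu.
have vE := eigenvector_limit_coord m2n lv cv.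
set c := complex.Re (u 0%N) in uE; set d := complex.Re (v 0%N) in vE.
(* If the two limits agreed, [u] and [v] would be multiples of one sequence; pairing with [u],
   orthogonal to [v], leaves [d = 0] and hence [v = 0]. *)
have e : lc c (fun=> 0) v = lc d (fun=> 0) u.
  apply/funext => k; have [ur ui] := uE k; have [vr vi] := vE k.
  apply: complex_ext; first by rewrite !Re_lc /= ur vr lij; ring.
  by rewrite !Im_lc ui vi !mulr0.
have d0 : d = 0.
  have := congr1 (fun w => rdot w u) e.
  by rewrite /= !rdot_lc0 // rdotC uv0 su mulr0 mulr1.
have v0 : v = fun=> 0.
  apply/funext => k; have [vr vi] := vE k.
  by apply: complex_ext; rewrite ?vr ?vi ?d0 ?mul0r.
by move/eqP: sv; rewrite v0 rdot0r eq_sym oner_eq0.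
Qed.

Lemma zlim_incr : {homo zlim : i j / (i < j)%N >-> i < j}.
Proof.
move=> i j ij; rewrite lt_neqAle; apply/andP; split.
  by apply/eqP; apply: zlim_neq; rewrite neq_ltn ij.
apply: ler_cvg_to (@zeros_cvg i) (@zeros_cvg j) _; exists j.+1 => // n /= jn.
by apply: ltW; apply: x_incr; rewrite ij.
Qed.

Lemma T_zero : T (fun=> 0, fun=> 0).
Proof. by rewrite -{1}(K_0 J_pos KT); exact/KT/ell2_0. Qed.

(** In the resolvent set [(T - z) v = 0] would have a single solution, but both 0 and the limit
    eigenvector solve it. *)
Lemma zlim_spectrum j : spectrum T (zlim j)%:C.
Proof.
have l0 : ell2 (fun=> 0 : R[i]) := ell2_0 R.
move=> [ed _]; have [v [_ vuniq]] := ed _ l0.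
have [||phi [u [_ lu _ su Tu]]] := @eigenvector_limit j (fun n => n + j.+1)%N.
- by move=> n; rewrite leq_addr.
- by move=> n; lia.
have e1 : v = u by apply: vuniq; exact/op_shift_real.
have e2 : v = fun=> 0.
  by apply: vuniq; apply/op_shift_real; rewrite (_ : lc _ _ _ = fun=> 0) //;
    [exact: T_zero|apply/funext => k; rewrite /lc mulr0 addr0].
by move/eqP: su; rewrite -e1 e2 rdot0r eq_sym oner_eq0.
Qed.

(** The gap bounds the solutions [y_n] of [(J_n - z) y = P_n g] by [|g| / d], hence also their
    Galerkin data [g + z y_n]; compactness yields a limit [v = K (g + z v)] with the same bound. *)
Lemma real_resolvent z (d : R) N : 0 < d ->
  (forall n j, (N <= n)%N -> (j < n)%N -> d <= `|x n j - z|) ->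
  resolvent_set T z%:C.
Proof.
move=> d0 dz.
have solve g : ell2 g -> exists v, [/\ ell2 v, T (v, lc z g v) &
    sqn v <= d ^- 2 * sqn g].
  move=> lg.
  have /choice[y yP] : forall n, exists y, galerkin a b (n + N) (lc z g y) y /\
      d ^+ 2 * sqn y <= sqn g.
    move=> n; have [|y gy yg] :=
      galerkin_shifted a_gt0 x_incr x_zero (n := n + N) (z := z) d0 lg.
      by move=> j jn; apply: dz => //; rewrite leq_addl.
    by exists y.
  have ly n : ell2 (y n) by have [[/supp_ell2]] := yP n.
  pose hn n := lc z g (y n).
  have lh n : ell2 (hn n) by exact: ell2_lc.
  have d2 : 0 < d ^+ 2 by rewrite exprn_gt0.
  have yb n : sqn (y n) <= d ^- 2 * sqn g.
    by have [_] := yP n; rewrite -ler_pdivlMl.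
  have bnd n : sqn (hn n) <= 2 * sqn g + 2 * z ^+ 2 * (d ^- 2 * sqn g).
    apply: le_trans (sqn_lc_le _ lg (ly n)) _; rewrite lerD2l.
    by apply: ler_wpM2l => //; rewrite mulr_ge0 ?sqr_ge0.
  have [phi [v [phi_incr lv cy cK]]] := galerkin_compact J_pos KT galerkin_exists
    K_compact lh bnd (fun n => leq_addr N n) (fun n => (yP n).1).
  exists v.
  have hl : l2cvg (hn \o phi) (lc z g v).
    apply: (@l2cvg_lc _ z (fun=> g) (y \o phi)) => //; last exact: l2cvg_cst.
    by move=> n; exact: ly.
  have lgv : ell2 (lc z g v) by exact: ell2_lc.
  have vK : v = K (lc z g v).
    have lKl : ell2 (K (lc z g v)) by exact: (ell2_K J_pos KT).
    apply: (l2cvg_uniq (un := (K \o hn) \o phi)) => //.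
      by move=> n; exact: (ell2_K J_pos KT).
    apply: (K_cvg J_pos KT K_compact (hn := hn \o phi)) => // n.
    exact: lh.
  split => //; first by rewrite {1}vK; exact: KT.
  have c := rdot_cvg_l2 (fun n => ly (phi n)) (fun n => ly (phi n)) lv lv cy cy.
  by apply: (cvgr_to_le c); apply: nearW => n; exact: yb.
(* The difference [y] of two solutions satisfies [T y = z y]. Solving [(T - z) p = y] and using
   symmetry gives [<y, y> = 0]. *)
have uniq g v v' : T (v, lc z g v) -> T (v', lc z g v') -> v = v'.
  move=> Tv Tv'.
  have [lv lgv] := friedrichs_ell2 J_pos Tv; have [lv' lgv'] := friedrichs_ell2 J_pos Tv'.
  apply: sqd_eq0 => //; pose y := lc (-1) v v'.
  have ly : ell2 y by exact: ell2_lc.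
  have lzy : ell2 (lc z (fun=> 0) y) by exact: ell2_lc0.
  have Ty : T (y, lc z (fun=> 0) y).
    have -> : lc z (fun=> 0) y = lc (-1) (lc z g v) (lc z g v').
      by rewrite lc_lc lcuu.
    rewrite {1}/y {1}(friedrichs_K J_pos KT Tv) {1}(friedrichs_K J_pos KT Tv').
    rewrite -(K_lc J_pos KT) //; apply: KT; exact: ell2_lc.
  have [p [lp Tp _]] := solve y ly.
  have := friedrichs_sym J_pos Tp Ty.
  rewrite (rdotC p) rdot_lc0 // rdot_lcl // (rdotC y p) /sqd -/y; lra.
split.
  move=> g lg; have [v [lv Tv _]] := solve g lg.
  exists v; split; first exact/op_shift_real.
  by move=> v' /op_shift_real; exact: uniq.
exists (d ^- 2) => g v /op_shift_real Tv.
have [lv lgv] := friedrichs_ell2 J_pos Tv.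
have lg : ell2 g.
  have -> : g = lc (- z) (lc z g v) v.
    by apply/funext => k; rewrite /lc rmorphN /= mulNr addrK.
  exact: ell2_lc.
have [v' [_ Tv' nv']] := solve g lg.
have vv' : v = v' := uniq _ _ _ Tv Tv'.
by rewrite !normsqE // -EFinM lee_fin vv'.
Qed.

(* Beyond the index where [zlim] exceeds [z + 1] all zeros stay at distance 1 from
   [z]; the finitely many others converge to limits different from [z]. *)
Lemma not_zlim_resolvent z : (forall j, zlim j != z) -> (exists m, z + 1 <= zlim m) ->
  resolvent_set T z%:C.
Proof.
move=> lz [m zm].
have near_j k : exists2 d, 0 < d & exists N, forall n j, (N <= n)%N -> (j < k)%N ->
    (j < n)%N -> d <= `|x n j - z|.
  elim: k => [|k [d d0 [N hN]]]; first by exists 1 => //; exists 0%N.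
  pose e := `|zlim k - z| / 2.
  have e0 : 0 < e by rewrite divr_gt0 // normr_gt0 subr_eq0.
  have [M _ hM] := (cvgrPdist_lt _ _).1 (@zeros_cvg k) _ e0.
  exists (Num.min d e); first by rewrite lt_min d0.
  exists (maxn N M) => n j; rewrite geq_max => /andP[Nn Mn].
  rewrite ltnS leq_eqVlt => /orP[/eqP -> kn|jk jn]; last first.
    by rewrite ge_min hN.
  rewrite ge_min; apply/orP; right.
  have := hM n Mn; rewrite /= => h.
  have := ler_distD (x n k) (zlim k) z; have : e * 2 = `|zlim k - z| by rewrite /e; lra.
  lra.
have [d d0 [N hN]] := near_j m.
apply: (@real_resolvent z (Num.min d 1) N); first by rewrite lt_min d0 ltr01.
move=> n j Nn jn; rewrite ge_min; have [jm|mj] := ltnP j m.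
  by rewrite hN.
have : zlim m <= zlim j.
  move: mj; rewrite leq_eqVlt => /orP[/eqP -> //|/zlim_incr/ltW //].
have := zlim_le jn => h1 h2; apply/orP; right.
rewrite ger0_norm; lra.
Qed.

End WithInverse.
End Spectrum.

(** Writing [s i = t (f i)], the map [f] is strictly increasing, so [i <= f i]. Used in both
    directions, it identifies two sequences with the same range. *)
Lemma increasing_range_le (R : realType) (s t : nat -> R) :
  {homo s : i j / (i < j)%N >-> i < j} -> {homo t : i j / (i < j)%N >-> i < j} ->
  (forall i, exists j, s i = t j) -> forall i, t i <= s i.
Proof.
move=> s_incr t_incr /choice[f fE].
have t_mono : {mono t : i j / (i < j)%N >-> i < j}.
  move=> i j; case: (ltngtP i j) => [/t_incr -> //|/t_incr/ltW|->].
    by rewrite leNgt => /negbTE.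
  by rewrite ltxx.
have f_incr : {homo f : i j / (i < j)%N}.
  by move=> i j /s_incr; rewrite !fE t_mono.
move=> i; rewrite fE; have := homo_ltn_ge f_incr i.
by rewrite leq_eqVlt => /orP[/eqP <- //|/t_incr/ltW].
Qed.

(** * Counting measures *)

(** Dominated convergence for sums whose length grows with [n]: a fixed head converges termwise, and
    the rest is at most twice a tail of [g]. *)
Lemma tannery (R : realType) (u : nat -> nat -> R) (l g : nat -> R) :
  (forall j, u n j @[n --> \oo] --> l j) ->
  (forall n j, (j < n)%N -> `|u n j| <= g j) -> cvgn (series g) ->
  cvgn (series l) /\
  \sum_(0 <= j < n) u n j @[n --> \oo] --> limn (series l).
Proof.
move=> ul ug cg.
have lg j : `|l j| <= g j.
  apply: (cvgr_to_le (cvg_norm (ul j))); exists j.+1 => // n /= jn; exact: ug.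
have g0 j : 0 <= g j by exact: le_trans (normr_ge0 _) (lg j).
have cl : cvgn (series l).
  apply: normed_cvg.
  exact: (series_le_cvg (fun j => normr_ge0 (l j)) g0 lg cg).
split => //.
have diff0 : \sum_(0 <= j < n) u n j - series l n @[n --> \oo] --> 0.
  (* The head is below [e / 8]; the tail of [g], counted twice, is at most [e / 4]. *)
  apply/cvgrPdist_le => e e0; have e4 : 0 < e / 8 by lra.
  have [N _ hN] := (cvgrPdist_lt _ _).1 cg _ e4.
  have tail n : (N <= n)%N -> \sum_(N <= j < n) g j <= e / 8 + e / 8.
    move=> Nn; have h1 := hN N (leqnn N); have h2 := hN n Nn.
    rewrite -(sub_series_geq g Nn) ; apply: le_trans (ler_norm _) _.
    rewrite (le_trans (ler_distD (limn (series g)) _ _)) // distrC.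
    by move: h1 h2; rewrite /=; lra.
  have head0 : \sum_(0 <= j < N) `|u n j - l j| @[n --> \oo] --> 0.
    pose D N n := \sum_(0 <= j < N) `|u n j - l j|.
    suff : D N n @[n --> \oo] --> 0 by [].
    elim: N {hN tail} => [|N ih].
      suff -> : D 0%N = fun=> 0 by exact: cvg_cst.
      by apply/funext => n; rewrite /D big_nil.
    have -> : D N.+1 = D N \+ (fun n => `|u n N - l N|).
      by apply/funext => n; rewrite /D big_nat_recr.
    rewrite -[X in _ --> X](addr0 0); apply: cvgD => //.
    by apply/norm_cvg0P/subr_cvg0; exact: ul.
  have [N2 _ hN2] := (cvgrPdist_lt _ _).1 head0 _ e4.
  exists (maxn N N2) => // n /=; rewrite geq_max => /andP[Nn N2n].
  have := hN2 n N2n; rewrite /= !sub0r !normrN => hd.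
  rewrite /series /= -sumrB (big_cat_nat (n := N)) //=.
  have t1 : `|\sum_(N <= j < n) (u n j - l j)| <= 2 * \sum_(N <= j < n) g j.
    rewrite mulr_sumr; apply: le_trans (ler_norm_sum _ _ _) _.
    apply: ler_sum_nat => j /andP[_ jn].
    by apply: le_trans (ler_normB _ _) _; have := ug n j jn; have := lg j; lra.
  have t0 := ler_norm_sum (index_iota 0 N) (fun j => u n j - l j) xpredT.
  apply: le_trans (ler_normD _ _) _.
  have := tail n Nn; have := ler_norm (\sum_(0 <= j < N) `|u n j - l j|); lra.
have -> : (fun n => \sum_(0 <= j < n) u n j) =
    (fun n => (\sum_(0 <= j < n) u n j - series l n) + series l n).
  by apply/funext => n; rewrite subrK.
by rewrite -[X in _ --> X]add0r; apply: cvgD.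
Qed.

Lemma integral_dirac_EFin (R : realType) (c : R) (f : R -> R) :
  measurable_fun setT f -> (\int[\d_c]_t (f t)%:E)%E = (f c)%:E.
Proof.
by move=> mf; rewrite integral_dirac ?diracT ?mul1e //; exact/measurable_EFinP.
Qed.

Lemma integral_zero_counting (R : realType) (x : nat -> nat -> R) n (f : R -> R) :
  measurable_fun setT f ->
  (\int[zero_counting_measure x n]_t (f t)%:E)%E = (\sum_(0 <= j < n) f (x n j))%:E.
Proof.
move=> mf.
have ge0 (h : R -> R) : measurable_fun setT h -> (forall t, 0 <= h t) ->
    (\int[zero_counting_measure x n]_t (h t)%:E)%E = (\sum_(0 <= j < n) h (x n j))%:E.
  move=> mh h0; rewrite ge0_integral_measure_sum //.
  - by under eq_bigr do rewrite integral_dirac_EFin //; rewrite sumEFin big_mkord.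
  - by move=> t _; rewrite lee_fin.
  - exact/measurable_EFinP.
have -> : (fun t => (f t)%:E) = EFin \o f by [].
(* Additivity in the measure is applied to the positive and negative parts separately. *)
rewrite integralE funerpos funerneg !ge0 //.
- rewrite -EFinB -sumrB; congr EFin; apply: eq_bigr => j _.
  by rewrite -[in RHS](funrposBneg f).
- exact: measurable_funrneg.
- exact: measurable_funrpos.
Qed.

Lemma integral_point_counting (R : realType) (zeta : nat -> R) (f : R -> R) :
  measurable_fun setT f ->
  (\sum_(0 <= j <oo) `|f (zeta j)|%:E < +oo)%E ->
  (\int[point_counting_measure zeta]_t (f t)%:E)%E =
  (limn (series (fun j => f (zeta j))))%:E.
Proof.
move=> mf sf; have mF : measurable_fun setT (EFin \o f) by exact/measurable_EFinP.
have le (h : R -> R) : (forall t, `|h t| <= `|f t|) -> measurable_fun setT h ->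
    (\sum_(n <oo) `|\int[\d_(zeta n)]_t (h t)%:E| < +oo)%E.
  move=> hf mh; apply: le_lt_trans sf; apply: lee_nneseries => // n _.
  by rewrite integral_dirac_EFin // lee_fin.
rewrite (@integral_measure_series _ _ R (fun j => \d_(zeta j)) setT) //=.
- transitivity (\sum_(n <oo) (f (zeta n))%:E)%E.
    by apply: eq_eseriesr => n _; rewrite integral_dirac_EFin.
  rewrite -EFin_lim.
    by congr (limn _); apply/funext => n /=; rewrite /series /= sumEFin.
  by apply: normed_cvg; exact: (nnseries_is_cvg (fun j => normr_ge0 (f (zeta j))) sf).
- move=> n; apply/integrableP; split => //=.
  by rewrite integral_dirac_EFin ?ltry //; exact: measurableT_comp.
- rewrite (funerneg f); apply: le; last exact: measurable_funrneg.
  move=> t; rewrite ger0_norm ?funrneg_ge0 // /funrneg /=.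
  by rewrite ge_max normr_ge0 -normrN ler_norm.
- rewrite (funerpos f); apply: le; last exact: measurable_funrpos.
  by move=> t; rewrite ger0_norm ?funrpos_ge0 // /funrpos /= ge_max normr_ge0 ler_norm.
Qed.

(** If all points stayed below [B], the terms would be at least [1 / w B] and could not tend to 0.
    This provides the large limit of zeros that [not_zlim_resolvent] asks for. *)
Lemma summable_weight_unbounded (R : realType) (zeta : nat -> R) (w : R -> R) :
  (forall t, 0 < w t) -> {homo w : s t / s <= t} ->
  cvgn (series (fun j => (w (zeta j))^-1)) -> forall B, exists m, B <= zeta m.
Proof.
move=> w0 wi /cvg_series_cvg_0 c0 B; apply: contrapT => nB.
have wB0 : 0 < (w B)^-1 by rewrite invr_gt0.
have [N _ /(_ N (leqnn N))] := (cvgrPdist_lt _ _).1 c0 _ wB0.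
rewrite /= sub0r normrN ger0_norm ?invr_ge0 ?ltW //.
rewrite ltf_pV2 ?posrE // => lt.
have : w (zeta N) <= w B.
  by apply: wi; rewrite leNgt; apply/negP => /ltW h; apply: nB; exists N.
by rewrite leNgt lt.
Qed.

Theorem theorem4p2 (R : realType) (a b : nat -> R)
  (a_gt0 : forall n, 0 < a n)
  (J_pos : op_positive (jacobi a b))
  (JF_inv_compact : compact_op (op_inverse (friedrichs (jacobi a b))))
  (zeta : nat -> R)
  (zeta0_gt0 : 0 < zeta 0%N)
  (zeta_incr : {homo zeta : i j / (i < j)%N >-> i < j})
  (zeta_spectrum :
     spectrum (friedrichs (jacobi a b)) = range (fun j => (zeta j)%:C))
  (w : R -> R)
  (w_gt0 : forall t, 0 < w t)
  (w_cont : continuous w)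
  (w_nondecr : {homo w : s t / s <= t})
  (w_sum : (\sum_(0 <= j <oo) ((w (zeta j))^-1)%:E < +oo)%E)
  (x : nat -> nat -> R)
  (x_incr : forall n i j, (i < j < n)%N -> x n i < x n j)
  (x_zero : forall n j, (j < n)%N -> root (orthonormal_poly a b n) (x n j))
  (f : R -> R)
  (f_cont : continuous f)
  (f_bounded : bounded_fun f)
  (wf_bounded : bounded_fun (w \* f)) :
  (\int[zero_counting_measure x n]_t (f t)%:E)%E @[n --> \oo]
    --> (\int[point_counting_measure zeta]_t (f t)%:E)%E.
Proof.
have [K [KT K_compact]] := inverse_exists J_pos JF_inv_compact.
have w_cvg : cvgn (series (fun j => (w (zeta j))^-1)).
  by apply: nnseries_is_cvg w_sum => j; rewrite invr_ge0 ltW.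
have zeta_unbounded := summable_weight_unbounded w_gt0 w_nondecr w_cvg.
have l_incr : {homo zlim x : i j / (i < j)%N >-> i < j}.
  exact: (zlim_incr a_gt0 J_pos x_incr x_zero KT K_compact).
have l_zeta i : exists j, zlim x i = zeta j.
  have : spectrum (friedrichs (jacobi a b)) (zlim x i)%:C.
    exact: (zlim_spectrum a_gt0 J_pos x_incr x_zero KT K_compact).
  by rewrite zeta_spectrum => -[j _ /complexI <-]; exists j.
have zeta_le := increasing_range_le l_incr zeta_incr l_zeta.
(* A [zeta i] that is no limit of zeros would be in the resolvent set; the limits are unbounded
   because they dominate [zeta]. *)
have zeta_l i : exists j, zeta i = zlim x j.
  apply: contrapT => nex.
  have : spectrum (friedrichs (jacobi a b)) (zeta i)%:C.
    by rewrite zeta_spectrum; exists i.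
  apply; apply: (not_zlim_resolvent a_gt0 J_pos x_incr x_zero KT K_compact).
    by move=> j; apply/eqP => lj; apply: nex; exists j.
  have [m zm] := zeta_unbounded (zeta i + 1); exists m.
  exact: le_trans zm (zeta_le m).
have lE j : zlim x j = zeta j.
  apply/eqP; rewrite eq_le zeta_le andbT.
  exact: (increasing_range_le zeta_incr l_incr zeta_l).
have x_cvg j : x n j @[n --> \oo] --> zeta j.
  by rewrite -lE; exact: (zeros_cvg a_gt0 J_pos x_incr x_zero).
have x_ge n j : (j < n)%N -> zeta j <= x n j.
  by rewrite -lE; exact: (zlim_le a_gt0 J_pos x_incr x_zero).
have mf : measurable_fun setT f by exact: continuous_measurable_fun.
have [M M0 hM] : exists2 M : R, 0 <= M & forall t, w t * `|f t| <= M.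
  (* Boundedness holds for constants strictly above [M0]; the absolute value makes the chosen one
     nonnegative. *)
  have [M0 [_ hM]] := wf_bounded; exists (`|M0| + 1); first by rewrite addr_ge0.
  have lt : M0 < `|M0| + 1 by apply: le_lt_trans (ler_norm _) _; rewrite ltrDl.
  move=> t; rewrite -[w t]ger0_norm ?(ltW (w_gt0 t)) // -normrM.
  exact: (hM _ lt t).
(* Zeros lie to the right of their limits and [w] is nondecreasing, whence the summable majorant
   [M / w (zeta j)]. *)
have f_le t s : s <= t -> `|f t| <= M * (w s)^-1.
  move=> st; rewrite ler_pdivlMr // mulrC; apply: le_trans (hM t).
  by apply: ler_wpM2r => //; exact: w_nondecr.
rewrite integral_point_counting //; last first.
  apply: (@le_lt_trans _ _ (\sum_(0 <= j <oo) (M%:E * ((w (zeta j))^-1)%:E))%E).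
    by apply: lee_nneseries => // j _; rewrite -EFinM lee_fin f_le.
  rewrite nneseriesZl; last by move=> j _; rewrite lee_fin invr_ge0 ltW.
  by apply: lte_mul_pinfty => //; rewrite lee_fin.
under eq_fun do rewrite integral_zero_counting //.
apply: cvg_EFin; first exact: nearW.
apply: (tannery (u := fun n j => f (x n j)) (g := fun j => M * (w (zeta j))^-1) _ _ _).2.
- by move=> j; exact: (continuous_cvg _ (f_cont (zeta j)) (x_cvg j)).
- by move=> n j jn; apply: f_le; exact: x_ge.
- by have := is_cvg_seriesZ (k := M) w_cvg.
Qed.
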